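(* Let $m$ be a positive integer and let $\Psi(x,z)$ be the normalized Baker--Akhiezer function for the deformed system $R=A_n(m)$. Let $\widetilde{\mathfrak R}$ be the ring of all polynomials $f(z)=\sum_{\nu\in P}f_\nu q^{2(\nu,z)}$ (finite sums) such that $f(z+se_i)=f(z+se_j)$ whenever $q^{2z_i}=q^{2z_j}$ ($1\le s\le m$, $1\le i<j\le n$) and $f(z+e_i)=f(z+\sqrt m\,e_{n+1})$ whenever $q^{1-m+2z_i}=q^{2\sqrt m\,z_{n+1}}$ ($1\le i\le n$). Then for each $f\in\widetilde{\mathfrak R}$ there exists a difference operator $D_f$ in $x$ on the lattice $P$, i.e. a finite sum $\sum_{\nu\in P}d_\nu(x)T_x^\nu$, such that $D_f\Psi=f(z)\Psi$. All these operators commute. For $$f=\mathfrak m(z)=q^{2z_1}+\dots+q^{2z_n}+\frac{q-q^{-1}}{q^m-q^{-m}}q^{2\sqrt m\,z_{n+1}}\in\widetilde{\mathfrak R}$$ the corresponding operator $D_f$ is the deformed Macdonald--Ruijsenaars operator $\widetilde D$ (in the variable $x$).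
   Context: $q\in\mathbb C^\times$ is not a root of unity, $\log q$ fixed, $q^a=e^{a\log q}$, $[a]=q^a-q^{-a}$. $e_1,\dots,e_{n+1}$ is the standard basis of $\mathbb R^{n+1}$, $(\cdot,\cdot)$ the standard scalar product extended bilinearly to $\mathbb C^{n+1}$; $x,z\in\mathbb C^{n+1}$; $T^v_x$ is the shift by $v$ in $x$. The deformed system $R=A_n(m)=R^0\cup R^1$: $R^0=\{\pm(e_i-e_j):1\le i<j\le n\}$ with $m_\alpha=m$, $R^1=\{\pm(e_i-\sqrt m\,e_{n+1}):1\le i\le n\}$ with $m_\alpha=1$; $R_+=\{e_i-e_j:1\le i<j\le n\}\cup\{e_i-\sqrt m\,e_{n+1}:1\le i\le n\}$; $\rho=\frac12\sum_{\alpha\in R_+}m_\alpha\alpha$; $P=\mathbb Ze_1\oplus\dots\oplus\mathbb Ze_n\oplus\sqrt m\,\mathbb Ze_{n+1}$. In the variable $x$, $\widetilde D=\widetilde a_1(x)T^{e_1}+\dots+\widetilde a_n(x)T^{e_n}+\widetilde a_{n+1}(x)T^{\sqrt m\,e_{n+1}}$ with, for $i\le n$, $$\widetilde a_i(x)=\frac{[x_i-\sqrt m\,x_{n+1}-\frac{m+1}2]}{[x_i-\sqrt m\,x_{n+1}-\frac{m-1}2]}\prod_{j\ne i,\,1\le j\le n}\frac{[x_i-x_j-m]}{[x_i-x_j]},\qquad\widetilde a_{n+1}(x)=\frac{[1]}{[m]}\prod_{j=1}^n\frac{[\sqrt m\,x_{n+1}-x_j-\frac{m+1}2]}{[\sqrt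 m\,x_{n+1}-x_j+\frac{m-1}2]}.$$ The normalized Baker--Akhiezer function for $R$ is the unique function $\Psi=q^{2(x,z)}\sum_\nu\psi_\nu(x)q^{2(\nu,z)}$, the sum over $\nu\in\rho+P$ lying in the polytope $\mathcal N=\{-\rho+\sum_{\alpha\in R_+}l_\alpha\alpha:0\le l_\alpha\le m_\alpha\}$, which satisfies in $z$ the same two families of conditions as in the definition of $\widetilde{\mathfrak R}$ and has $\psi_\rho(x)=\prod_{\alpha\in R_+}\prod_{j=1}^{m_\alpha}[(\alpha,\frac12j\alpha-x)]$. *)

(* Defs.v *)
From HB Require Import structures.
From mathcomp Require Import all_boot all_order all_algebra.
From mathcomp Require Import complex.
From mathcomp Require Import all_classical all_reals all_analysis.

Set Implicit Arguments.
Unset Strict Implicit.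
Unset Printing Implicit Defensive.

Import Order.TTheory GRing.Theory Num.Theory.
Import numFieldNormedType.Exports.

Local Open Scope classical_set_scope.
Local Open Scope ring_scope.
Local Open Scope complex_scope.

(* Indexing: coordinates 1, ..., n of the (n+1)-dimensional space are
   [lift ord_max i] for i : 'I_n, and coordinate n+1 is [ord_max]. *)

(* Needed for the topology and differentiability on 'rV[R[i]]. *)
HB.instance Definition _ (R : realType) :=
  NormedModule.copy R[i] (R[i] : numFieldType)^o.

(** Complex exponential; [qpow l a] is q^a = e^(a log q) with l = log q, and
    [qbr l a] is q^a - q^(-a). *)

Definition cexp (R : realType) (z : R[i]) : R[i] :=
  let: a +i* b := z in (expR a * cos b) +i* (expR a * sin b).

Definition qpow (R : realType) (l a : R[i]) : R[i] := cexp (a * l).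

Definition qbr (R : realType) (l a : R[i]) : R[i] := qpow l a - qpow l (- a).

(** Functions of x are total functions on C^(n+1), with arbitrary values at
    poles.  Identities between meromorphic functions are therefore required
    on a dense open set; for meromorphic functions this is the same as
    equality in the field of meromorphic functions. *)

Definition generically (R : realType) (n : nat)
    (Q : 'rV[R[i]]_n.+1 -> Prop) : Prop :=
  exists U : set 'rV[R[i]]_n.+1, [/\ open U, dense U & forall x, U x -> Q x].

(* Complex differentiability: the base field of the normed modules is R[i]. *)
Definition holomorphic_at (R : realType) (n : nat)
    (f : 'rV[R[i]]_n.+1 -> R[i]) (x : 'rV[R[i]]_n.+1) : Prop :=
  differentiable f x.

(* Locally a quotient g / h of holomorphic functions; the closure condition
   says that h vanishes identically on no nonempty open set near p. *)
Definition meromorphic (R : realType) (n : nat)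
    (f : 'rV[R[i]]_n.+1 -> R[i]) : Prop :=
  forall p : 'rV[R[i]]_n.+1, exists g h : 'rV[R[i]]_n.+1 -> R[i],
    \forall x \near p,
      [/\ holomorphic_at g x, holomorphic_at h x,
          closure [set y | h y != 0] x & h x != 0 -> f x = g x / h x].

Definition toC (R : realType) (n : nat) (v : 'rV[R]_n) : 'rV[R[i]]_n :=
  map_mx (real_complex R) v.

Definition dotp (R : realType) (n : nat) (u v : 'rV[R[i]]_n) : R[i] :=
  \sum_(i < n) u ord0 i * v ord0 i.

Definition ev (R : realType) (n : nat) (i : 'I_n) : 'rV[R]_n := delta_mx ord0 i.

Definition sqm (R : realType) (m : nat) : R := Num.sqrt (m%:R).

(* R_+ : [inl (i, j)] with i < j is e_i - e_j, and [inr i] is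
   e_i - sqrt m e_(n+1). *)
Definition posroot (n : nat) : finType :=
  ({p : 'I_n * 'I_n | (p.1 < p.2)%N} + 'I_n)%type.

Definition root_vec (R : realType) (n m : nat) (a : posroot n) : 'rV[R]_n.+1 :=
  match a with
  | inl p => ev R (lift ord_max (val p).1) - ev R (lift ord_max (val p).2)
  | inr i => ev R (lift ord_max i) - sqm R m *: ev R ord_max
  end.

Definition root_mult (n m : nat) (a : posroot n) : nat :=
  if a is inl _ then m else 1%N.

Definition rho (R : realType) (n m : nat) : 'rV[R]_n.+1 :=
  2^-1 *: \sum_(a : posroot n) (root_mult m a)%:R *: root_vec R m a.

(* Basis e_1, ..., e_n, sqrt m e_(n+1) of the lattice P. *)
Definition lat_basis (R : realType) (n m : nat) (i : 'I_n.+1) : 'rV[R]_n.+1 :=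
  (if i == ord_max then sqm R m else 1) *: ev R i.

Definition latP (R : realType) (n m : nat) : set 'rV[R]_n.+1 :=
  [set v | exists k : 'I_n.+1 -> int,
     v = \sum_(i < n.+1) (k i)%:~R *: lat_basis R m i].

Definition polytopeN (R : realType) (n m : nat) : set 'rV[R]_n.+1 :=
  [set v | exists c : posroot n -> R,
     (forall a, 0 <= c a <= (root_mult m a)%:R) /\
     v = - rho R n m + \sum_(a : posroot n) c a *: root_vec R m a].

(* (rho + P) `&` N *)
Definition ba_support (R : realType) (n m : nat) : set 'rV[R]_n.+1 :=
  [set v | latP m (v - rho R n m) /\ polytopeN m v].

Definition quasi_invariant (R : realType) (n m : nat) (l : R[i])
    (F : 'rV[R[i]]_n.+1 -> R[i]) : Prop :=
  (forall (i j : 'I_n) (s : nat) (z : 'rV[R[i]]_n.+1),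
     (i < j)%N -> (1 <= s <= m)%N ->
     qpow l (2 * z ord0 (lift ord_max i)) =
       qpow l (2 * z ord0 (lift ord_max j)) ->
     F (z + toC (s%:R *: ev R (lift ord_max i))) =
       F (z + toC (s%:R *: ev R (lift ord_max j)))) /\
  (forall (i : 'I_n) (z : 'rV[R[i]]_n.+1),
     qpow l (1 - m%:R + 2 * z ord0 (lift ord_max i)) =
       qpow l (2 * (sqm R m)%:C * z ord0 ord_max) ->
     F (z + toC (ev R (lift ord_max i))) =
       F (z + toC (sqm R m *: ev R ord_max))).

Definition Rtilde (R : realType) (n m : nat) (l : R[i]) :
    set ('rV[R[i]]_n.+1 -> R[i]) :=
  [set f |
     (exists (s : seq 'rV[R]_n.+1) (c : 'rV[R]_n.+1 -> R[i]),
        (forall nu, nu \in s -> latP m nu) /\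
        (forall z, f z = \sum_(nu <- s) c nu * qpow l (2 * dotp (toC nu) z))) /\
     quasi_invariant m l f].

(** The normalized Baker--Akhiezer function, with coefficients [psi nu]
    meromorphic in x.  The sum over [ba_support] is a finite sum, the polytope
    being bounded.  Uniqueness of Psi is up to generic equality in x. *)
Definition normalized_BA (R : realType) (n m : nat) (l : R[i])
    (Psi : 'rV[R[i]]_n.+1 -> 'rV[R[i]]_n.+1 -> R[i]) : Prop :=
  exists psi : 'rV[R]_n.+1 -> 'rV[R[i]]_n.+1 -> R[i],
  [/\ forall nu, meromorphic (psi nu),
      generically (fun x => forall z,
        Psi x z = qpow l (2 * dotp x z) *
          \sum_(nu \in ba_support m)
             psi nu x * qpow l (2 * dotp (toC nu) z)),
      generically (fun x => quasi_invariant m l (Psi x)) &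
      generically (fun x =>
        psi (rho R n m) x =
        \prod_(a : posroot n) \prod_(1 <= j < (root_mult m a).+1)
          let alpha := toC (root_vec R m a) in
          qbr l (dotp alpha ((j%:R / 2) *: alpha - x)))].

(* The finite sum of the [dcoef t] T^[dshift t]; shifts may be repeated, and
   [diffop_eq] identifies operators up to generic equality. *)
Record diffop (R : realType) (n : nat) := DiffOp {
  dlen : nat;
  dshift : 'I_dlen -> 'rV[R]_n.+1;
  dcoef : 'I_dlen -> 'rV[R[i]]_n.+1 -> R[i]
}.

Definition dapp (R : realType) (n : nat) (D : diffop R n)
    (F : 'rV[R[i]]_n.+1 -> R[i]) (x : 'rV[R[i]]_n.+1) : R[i] :=
  \sum_(t < dlen D) dcoef t x * F (x + toC (dshift t)).

Definition diffop_on_P (R : realType) (n m : nat) (D : diffop R n) : Prop :=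
  forall t : 'I_(dlen D), latP m (dshift t) /\ meromorphic (dcoef t).

Definition diffop_eq (R : realType) (n : nat) (D E : diffop R n) : Prop :=
  generically (fun x => forall F, dapp D F x = dapp E F x).

Definition diffop_commute (R : realType) (n : nat) (D E : diffop R n) : Prop :=
  generically (fun x => forall F, dapp D (dapp E F) x = dapp E (dapp D F) x).

Definition corresponds (R : realType) (n m : nat)
    (Psi : 'rV[R[i]]_n.+1 -> 'rV[R[i]]_n.+1 -> R[i])
    (f : 'rV[R[i]]_n.+1 -> R[i]) (D : diffop R n) : Prop :=
  diffop_on_P m D /\
  generically (fun x => forall z, dapp D (Psi ^~ z) x = f z * Psi x z).

Definition amr (R : realType) (n m : nat) (l : R[i]) (i : 'I_n)
    (x : 'rV[R[i]]_n.+1) : R[i] :=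
  let xi := x ord0 (lift ord_max i) in
  let w := (sqm R m)%:C * x ord0 ord_max in
  qbr l (xi - w - (m%:R + 1) / 2) / qbr l (xi - w - (m%:R - 1) / 2) *
  \prod_(j < n | j != i)
    (qbr l (xi - x ord0 (lift ord_max j) - m%:R) /
     qbr l (xi - x ord0 (lift ord_max j))).

Definition amr_last (R : realType) (n m : nat) (l : R[i])
    (x : 'rV[R[i]]_n.+1) : R[i] :=
  let w := (sqm R m)%:C * x ord0 ord_max in
  qbr l 1 / qbr l m%:R *
  \prod_(j < n)
    (qbr l (w - x ord0 (lift ord_max j) - (m%:R + 1) / 2) /
     qbr l (w - x ord0 (lift ord_max j) + (m%:R - 1) / 2)).

Definition Dtilde (R : realType) (n m : nat) (l : R[i]) : diffop R n :=
  DiffOp (dlen := n.+1) (lat_basis R m)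
    (fun t => if unlift ord_max t is Some i then amr m l i else amr_last m l).

Definition mfrak (R : realType) (n m : nat) (q l : R[i])
    (z : 'rV[R[i]]_n.+1) : R[i] :=
  \sum_(i < n) qpow l (2 * z ord0 (lift ord_max i)) +
  (q - q^-1) / (q ^+ m - q ^- m) * qpow l (2 * (sqm R m)%:C * z ord0 ord_max).

Arguments mfrak {R} n m q l z.

(* Main.v *)
Require Import Defs.
From mathcomp Require Import all_boot all_order all_algebra.
From mathcomp Require Import complex.
From mathcomp Require Import all_classical all_reals all_analysis.
From mathcomp Require Import ring lra zify.
Import Order.TTheory GRing.Theory Num.Theory.
Import numFieldNormedType.Exports.

Set Implicit Arguments.
Unset Strict Implicit.
Unset Printing Implicit Defensive.

Local Open Scope classical_set_scope.
Local Open Scope ring_scope.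
Local Open Scope complex_scope.

(** Write [b_1, ..., b_(n+1)] for the basis [e_1, ..., e_n, sqrt m e_(n+1)] of
    the lattice.  In coordinates with respect to this basis the roots are those
    of type A: they are the differences [b_p - b_r], and the two families of
    conditions on functions of [z] become one, attached to the pairs [p < r].
    Expand a function with these invariances into exponentials, for a fixed
    generic [x].  Exponentials being independent, the condition attached to a
    root splits into relations along the strings of exponents in the direction
    of this root ([string_relation]); there are as many relations per string as
    the multiplicity [M] of the root.  By a Vandermonde argument a string that
    carries a non-zero function has two points at distance at least [M], and if
    the distance is exactly [M] the quotient of the coefficients at its two
    ends is known ([edge_relation]).

    Existence of [D_f].  The product [f Psi] has the invariance of [Psi].
    Eliminate its exponents one after the other, in colexicographic order, by
    subtracting multiples of translates of [Psi] ([eliminate]).  The top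
    coefficient of [Psi] is an explicit product of quantum numbers, hence
    invertible for generic [x].  What has to be shown is that the process
    stops, i.e. that the shifts used stay in a bounded region.  This is a
    consequence of the length of the strings: starting from the first exponent
    of the remainder and going down along the roots [b_i - b_(i+1)],
    [b_i - b_(i+2)], ... in this order, one finds an exponent whose [i]-th
    coordinate is smaller by the whole extent of the polytope of [Psi] in this
    direction ([string_room], [room_below_first]).  So lower bounds for the
    coordinates of the exponents of [f] are lower bounds for those of the
    shifts, and as the coordinates of the roots sum to 0, the sum of the
    coordinates of a shift is bounded as well.

    Commutativity and uniqueness.  A difference operator is determined by its
    action on [Psi], since the first of its shifts contributes an exponent that
    nothing else can cancel ([Psi_separates]).  Now [D_f D_g] and [D_g D_f]
    both multiply [Psi] by [f g].

    The operator of [mfrak].  Here the bounds on the shifts leave only a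
    simplex with vertices [b_p], so that the operator is a combination of the
    [n + 1] shifts by these vectors.  Its [p]-th coefficient is found by
    comparing coefficients at the vertex of the polytope where the [p]-th
    coordinate is largest.  The coefficient of [Psi] there follows from the top
    coefficient by applying the edge relation along a path of edges
    ([vertex_coefficient]); its quotient by its translate telescopes to the
    coefficient of [Dtilde] ([Dtilde_eigen]). *)

(** * The complex exponential *)

Section ComplexExponential.
Variable R : realType.
Implicit Types (a b l : R[i]) (x y : R).

Lemma cexpD a b : cexp (a + b) = cexp a * cexp b.
Proof.
case: a => a1 a2; case: b => b1 b2; apply/eqP; rewrite eq_complex /=.
by rewrite expRD cosD sinD; apply/andP; split; apply/eqP; ring.
Qed.

Lemma cexp0 : cexp (0 : R[i]) = 1.
Proof.
apply/eqP; rewrite eq_complex /= expR0 cos0 sin0.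
by apply/andP; split; apply/eqP; ring.
Qed.

Lemma cexp_neq0 a : cexp a != 0.
Proof.
have : cexp a * cexp (- a) != 0 by rewrite -cexpD subrr cexp0 oner_neq0.
by rewrite mulf_eq0 negb_or => /andP[].
Qed.

Lemma linearization_at0 (f : R -> R) (df : R) : is_derive (0 : R) 1 f df ->
  forall e, 0 < e -> exists2 d, 0 < d &
    forall x, `|x| < d -> `|f x - f 0 - df * x| <= e * `|x|.
Proof.
move=> [f1 f2] e e0.
have : (fun h => h^-1 *: ((f \o shift 0) (h *: (1 : R)) - f 0)) @ 0^' --> df.
  by rewrite -f2; exact: f1.
move=> /cvgrPdist_le /(_ _ e0).
rewrite near_withinE near_simpl => /nbhs_ballP[d /= d0 H].
exists d => // x xd; have [->|x0] := eqVneq x 0.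
  by rewrite normr0 mulr0 subrr mulr0 subr0 normr0.
have := H x; rewrite /ball /= sub0r normrN => /(_ xd x0).
rewrite addr0 /GRing.scale /= mulr1 => Hx.
rewrite (_ : f x - f 0 - df * x = - ((df - x^-1 * (f x - f 0)) * x)).
  by rewrite normrN normrM; exact: ler_wpM2r.
by field.
Qed.

Lemma norm_complex_le x y : `|x +i* y| <= (`|x| + `|y|)%:C.
Proof.
rewrite [x +i* y]complexE /=; apply: (le_trans (ler_normD _ _)).
rewrite normrM rmorphD /= lerD //.
  by rewrite normc_def /= expr0n addr0 sqrtr_sqr lexx.
rewrite !normc_def /= !expr0n /= expr1n add0r addr0 sqrtr1 sqrtr_sqr mul1r.
exact: lexx.
Qed.

Lemma norm_Re_le a : `|complex.Re a|%:C <= `|a|. Proof. exact: normc_ge_Re. Qed.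

Lemma norm_Im_le a : `|complex.Im a|%:C <= `|a|.
Proof.
rewrite normc_def lecR -sqrtr_sqr ler_wsqrtr //.
by rewrite lerDr sqr_ge0.
Qed.

(** The first order expansions of [expR], [cos] and [sin] at the origin combine
    into that of [cexp], since the real and imaginary parts of [a] are bounded
    by its norm. *)
Lemma cexp_expansion (e : R) : 0 < e -> e < 1 -> exists2 d, 0 < d &
  forall a, `|a| < d%:C -> `|cexp a - 1 - a| <= (12 * e)%:C * `|a|.
Proof.
move=> e0 e1.
have [d1 d10 H1] := linearization_at0 (is_derive_expR 0) e0.
have [d2 d20 H2] := linearization_at0 (is_derive_sin 0) e0.
have [d3 d30 H3] := linearization_at0 (is_derive_cos 0) e0.
pose d := Num.min (Num.min d1 d2) (Num.min d3 (e / 2)).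
have d0 : 0 < d by rewrite !lt_min d10 d20 d30 divr_gt0.
exists d => // a ad.
have ha : `|complex.Re a| < d by rewrite -ltcR; exact: le_lt_trans (norm_Re_le a) ad.
have hb : `|complex.Im a| < d by rewrite -ltcR; exact: le_lt_trans (norm_Im_le a) ad.
have hN : (12 * e)%:C * `|a| = (6 * e)%:C * `|a| + (6 * e)%:C * `|a|.
  by rewrite -mulrDl -rmorphD /= (_ : 6 * e + 6 * e = 12 * e) //; ring.
have := norm_Re_le a; have := norm_Im_le a.
rewrite hN {hN ad}; case: a ha hb => a b /=.
rewrite !lt_min => /andP[/andP[a1 a2] /andP[a3 a4]].
move=> /andP[/andP[b1 b2] /andP[b3 b4]] hb ha.
have := H1 _ a1; have := H2 _ b2; have := H3 _ b3.
rewrite expR0 cos0 sin0 !subr0 oppr0 mul0r !mul1r subr0.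
set E := expR a; set S := sin b; set C := cos b => h3 h2 h1.
have hE1 : `|E - 1| <= 2 * `|a|.
  rewrite (_ : E - 1 = (E - 1 - a) + a); last by ring.
  apply: le_trans (ler_normD _ _) _.
  have h : e * `|a| <= 1 * `|a| by rewrite ler_wpM2r // ltW.
  lra.
have hE : `|E| <= 2.
  rewrite (_ : E = (E - 1) + 1); last by ring.
  apply: le_trans (ler_normD _ _) _; rewrite normr1; lra.
rewrite (_ : _ - 1 - _ = (E * (C - 1) + (E - 1 - a)) +i*
                         (E * (S - b) + (E - 1) * b)); last first.
  by apply/eqP; rewrite eq_complex /=; apply/andP; split; apply/eqP; ring.
apply: le_trans (norm_complex_le _ _) _.
apply: (@le_trans _ _ (6 * e * `|a| + 6 * e * `|b|)%:C); last first.
  have hM x : (6 * e * x)%:C = (6 * e)%:C * x%:C by rewrite -rmorphM.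
  rewrite rmorphD /= !hM lerD // ler_wpM2l // ler0c; lra.
have e2 : 2 * `|a| <= e by lra.
have p1 : `|E * (C - 1) + (E - 1 - a)| <= 2 * (e * `|b|) + e * `|a|.
  apply: le_trans (ler_normD _ _) _; rewrite lerD // normrM.
  by apply: ler_pM.
have p2 : `|E * (S - b) + (E - 1) * b| <= 2 * (e * `|b|) + e * `|b|.
  apply: le_trans (ler_normD _ _) _; rewrite lerD // normrM.
    by apply: ler_pM.
  by apply: ler_wpM2r => //; lra.
rewrite lecR; have : 0 <= e * `|a| by rewrite mulr_ge0 // ltW.
have : 0 <= e * `|b| by rewrite mulr_ge0 // ltW.
lra.
Qed.

(** By [cexpD] it is enough to differentiate at the origin. *)
Lemma derivable_cexp a : derivable (@cexp R) a 1.
Proof.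
apply/cvg_ex; exists (cexp a); apply/cvgrPdist_le => e e0.
case: e e0 => e ei; rewrite ltcE /= => /andP[/eqP -> e0].
have [k0' hk0'] : exists k, `|cexp a| = k%:C by rewrite normc_def; eexists.
pose k := Num.max 1 k0'.
have k1 : 1 <= k by rewrite le_max lexx.
have kc : `|cexp a| <= k%:C by rewrite hk0' lecR le_max lexx orbT.
have k0 : 0 < k by apply: lt_le_trans k1.
pose e' := Num.min (2^-1) (e / (12 * k)).
have e'0 : 0 < e' by rewrite lt_min invr_gt0 ltr0n divr_gt0 // mulr_gt0.
have e'1 : e' < 1 by rewrite gt_min invf_lt1 ?ltr1n.
have e'e : k * (12 * e') <= e.
  rewrite mulrCA mulrA -ler_pdivlMl ?mulr_gt0 // mulrC.
  by rewrite ge_min lexx orbT.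
have [d d0 H] := cexp_expansion e'0 e'1.
rewrite near_withinE near_simpl; apply/nbhs_ballP.
exists (d%:C); first by rewrite /= ltcR.
move=> h; rewrite /ball /= sub0r normrN => hd h0.
rewrite (_ : cexp a - _ = - (cexp a * (h^-1 * (cexp h - 1 - h)))); last first.
  by rewrite /GRing.scale /= mulr1 cexpD; field.
rewrite normrN !normrM normfV.
apply: (@le_trans _ _ (k%:C * (12 * e')%:C)); last by rewrite -rmorphM lecR.
by apply: ler_pM => //; rewrite ler_pdivrMl ?normr_gt0 // mulrC; exact: H.
Qed.

End ComplexExponential.

(** * Generic sets and meromorphic functions *)

Section GenericSets.
Variables (R : realType) (n : nat).
Implicit Types (P Q : 'rV[R[i]]_n.+1 -> Prop) (v x : 'rV[R[i]]_n.+1).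

Lemma generically_all_points Q : (forall x, Q x) -> generically Q.
Proof.
move=> H; exists setT; split=> //; first exact: openT.
by move=> O O0 _; rewrite setIT.
Qed.

Lemma generically_imply P Q :
  generically P -> (forall x, P x -> Q x) -> generically Q.
Proof. by move=> [U [oU dU H]] HPQ; exists U; split=> // x /H /HPQ. Qed.

Lemma generically_and P Q :
  generically P -> generically Q -> generically (fun x => P x /\ Q x).
Proof.
move=> [U [oU dU HU]] [V [oV dV HV]]; exists (U `&` V); split.
- exact: openI.
- exact: denseI.
- by move=> x [/HU ? /HV].
Qed.

Lemma generically_all_in (I : eqType) (s : seq I)
    (Q : I -> 'rV[R[i]]_n.+1 -> Prop) :
  (forall i, i \in s -> generically (Q i)) ->
  generically (fun x => forall i, i \in s -> Q i x).
Proof.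
elim: s => [|i s IH] H; first exact: generically_all_points.
have Hi : generically (Q i) by apply: H; rewrite mem_head.
have Hs : generically (fun x => forall j, j \in s -> Q j x).
  by apply: IH => j js; apply: H; rewrite in_cons js orbT.
apply: (generically_imply (generically_and Hi Hs)) => x [Qi Qs] j.
by rewrite in_cons => /orP[/eqP ->//|/Qs].
Qed.

Lemma generically_finType (I : finType) (Q : I -> 'rV[R[i]]_n.+1 -> Prop) :
  (forall i, generically (Q i)) -> generically (fun x => forall i, Q i x).
Proof.
move=> H; have := @generically_all_in I (enum I) Q (fun i _ => H i).
by move/generically_imply; apply=> x Hx i; apply: Hx; rewrite mem_enum.
Qed.

Lemma open_translate v (U : set 'rV[R[i]]_n.+1) :
  open U -> open [set x | U (x + v)].
Proof.
move=> oU; have cs : continuous (fun x : 'rV[R[i]]_n.+1 => x + v).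
  move=> x; apply: differentiable_continuous.
  by apply: differentiableD; [exact: ex_diff | exact: differentiable_cst].
exact: (open_comp _ oU).
Qed.

Lemma generically_translate v Q :
  generically Q -> generically (fun x => Q (x + v)).
Proof.
move=> [U [oU dU HU]]; exists [set x | U (x + v)]; split.
- exact: open_translate.
- move=> O [y Oy] oO.
  have [|z [/= Oz Uz]] := dU _ _ (open_translate (v := - v) oO).
    by exists (y + v); rewrite /= addrK.
  by exists (z - v); split=> //=; rewrite subrK.
- by move=> x /HU.
Qed.

End GenericSets.

Section Meromorphic.
Variables (R : realType) (n : nat).
Implicit Types (f g h : 'rV[R[i]]_n.+1 -> R[i]) (v x : 'rV[R[i]]_n.+1).

Lemma holomorphicM f g x : holomorphic_at f x -> holomorphic_at g x ->
  holomorphic_at (fun y => f y * g y) x.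
Proof. by move=> hf hg; exact: differentiableM hf hg. Qed.

Lemma holomorphicD f g x : holomorphic_at f x -> holomorphic_at g x ->
  holomorphic_at (fun y => f y + g y) x.
Proof. by move=> hf hg; exact: differentiableD hf hg. Qed.

Lemma holomorphicB f g x : holomorphic_at f x -> holomorphic_at g x ->
  holomorphic_at (fun y => f y - g y) x.
Proof. by move=> hf hg; exact: differentiableB hf hg. Qed.

Lemma holomorphic_cst c x : holomorphic_at (fun=> c : R[i]) x.
Proof. exact: differentiable_cst. Qed.

Lemma holomorphic_coord i x :
  holomorphic_at (fun y : 'rV[R[i]]_n.+1 => y ord0 i) x.
Proof. exact: differentiable_coord. Qed.

Lemma holomorphic_cexp f x :
  holomorphic_at f x -> holomorphic_at (fun y => cexp (f y)) x.
Proof.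
move=> hf; apply: (@differentiable_comp _ _ _ _ f (@cexp R) x hf).
by apply/derivable1_diffP; exact: derivable_cexp.
Qed.

Lemma holomorphic_prod (I : Type) (s : seq I) (P : pred I)
    (F : I -> 'rV[R[i]]_n.+1 -> R[i]) x :
  (forall i, P i -> holomorphic_at (F i) x) ->
  holomorphic_at (fun y => \prod_(i <- s | P i) F i y) x.
Proof.
move=> H; elim: s => [|i s IH].
  under eq_fun do rewrite big_nil; exact: holomorphic_cst.
under eq_fun do rewrite big_cons.
by case Pi: (P i) => //; apply: holomorphicM => //; exact: H.
Qed.

Lemma holomorphic_translate v f x :
  holomorphic_at f (x + v) -> holomorphic_at (fun y => f (y + v)) x.
Proof.
move=> hf; apply: (@differentiable_comp _ _ _ _ (fun y => y + v) f x _ hf).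
by apply: differentiableD; [exact: ex_diff | exact: differentiable_cst].
Qed.

Lemma nonvanishing_nbhs f x :
  holomorphic_at f x -> f x != 0 -> \forall y \near x, f y != 0.
Proof.
move=> hf fx; apply: (@cvgr_neq0 _ _ _ (nbhs x) _ f (f x)) => //.
exact: differentiable_continuous.
Qed.

Lemma meromorphic_open f p : meromorphic f ->
  exists g h (U : set 'rV[R[i]]_n.+1), [/\ open U, U p & forall x, U x ->
    [/\ holomorphic_at g x, holomorphic_at h x,
        closure [set y | h y != 0] x & h x != 0 -> f x = g x / h x]].
Proof.
move=> /(_ p)[g [h H]].
pose W := [set x | [/\ holomorphic_at g x, holomorphic_at h x,
  closure [set y | h y != 0] x & h x != 0 -> f x = g x / h x]].
have pW : nbhs (p : 'rV[R[i]]_n.+1) (interior W) by exact: nbhs_interior H.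
exists g, h, (interior W); split; last by move=> x /interior_subset.
- exact: open_interior.
- exact: nbhs_singleton pW.
Qed.

Lemma open_meromorphic f :
  (forall p, exists g h (U : set 'rV[R[i]]_n.+1), [/\ open U, U p & forall x, U x ->
    [/\ holomorphic_at g x, holomorphic_at h x,
        closure [set y | h y != 0] x & h x != 0 -> f x = g x / h x]]) ->
  meromorphic f.
Proof.
move=> H p; have [g [h [U [oU Up HU]]]] := H p; exists g, h.
have pU : nbhs (p : 'rV[R[i]]_n.+1) U by exact: open_nbhs_nbhs.
exact: (filterS HU pU).
Qed.

Lemma meromorphic_quotient g h : (forall x, holomorphic_at g x) ->
  (forall x, holomorphic_at h x) -> generically (fun x => h x != 0) ->
  meromorphic (fun x => g x / h x).
Proof.
move=> Hg Hh [U [oU dU HU]]; apply: open_meromorphic => p.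
exists g, h, setT; split=> [||x _]; [exact: openT | by [] | split=> //].
move=> B Bx; have [||y [By Uy]] := dU (interior B).
- by exists x; apply: nbhs_singleton; apply: nbhs_interior.
- exact: open_interior.
- by exists y; split; [exact: HU | exact: interior_subset].
Qed.

Lemma meromorphic_holomorphic g :
  (forall x, holomorphic_at g x) -> meromorphic g.
Proof.
move=> Hg; rewrite (_ : g = fun x => g x / 1).
  apply: meromorphic_quotient => //; first by move=> x; exact: holomorphic_cst.
  by apply: generically_all_points => x; rewrite oner_neq0.
by apply/funext => x; rewrite divr1.
Qed.

Lemma meromorphic_cst c : meromorphic (fun _ : 'rV[R[i]]_n.+1 => c : R[i]).
Proof. by apply: meromorphic_holomorphic => x; exact: holomorphic_cst. Qed.

(** Arbitrarily close to [x] there is a point where the first factor is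
    non-zero; there it stays non-zero on a neighbourhood, in which the second
    factor is non-zero somewhere. *)
Lemma closure_nonvanishingM (U : set 'rV[R[i]]_n.+1) h k x : open U -> U x ->
  (forall y, U y -> holomorphic_at h y) ->
  closure [set y | h y != 0] x ->
  (forall y, U y -> closure [set z | k z != 0] y) ->
  closure [set y | h y * k y != 0] x.
Proof.
move=> oU Ux Hh ch ck B Bx.
have [y [/= hy [By Uy]]] : exists y, h y != 0 /\ ((interior B) `&` U) y.
  have [|y [hy Hy]] := ch ((interior B) `&` U).
    by apply: filterI; [exact: nbhs_interior | exact: open_nbhs_nbhs].
  by exists y.
have [|z [/= kz [Bz hz]]] := ck y Uy (B `&` [set z | h z != 0]).
  apply: filterI; first exact: By.
  by apply: nonvanishing_nbhs => //; exact: Hh.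
by exists z; split=> //=; rewrite mulf_neq0.
Qed.

Lemma meromorphicM f g :
  meromorphic f -> meromorphic g -> meromorphic (fun x => f x * g x).
Proof.
move=> Hf Hg; apply: open_meromorphic => p.
have [f1 [f2 [U [oU Up HU]]]] := meromorphic_open p Hf.
have [g1 [g2 [V [oV Vp HV]]]] := meromorphic_open p Hg.
exists (fun x => f1 x * g1 x), (fun x => f2 x * g2 x), (U `&` V).
split=> [||x [Ux Vx]]; [exact: openI | by [] |].
have [hf1 hf2 cf ef] := HU x Ux; have [hg1 hg2 cg eg] := HV x Vx.
split; [exact: holomorphicM | exact: holomorphicM | |].
  have HfU y : (U `&` V) y -> holomorphic_at f2 y by move=> [/HU[]].
  have HgU y : (U `&` V) y -> closure [set z | g2 z != 0] y by move=> [_ /HV[]].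
  exact: closure_nonvanishingM (openI oU oV) (conj Ux Vx) HfU cf HgU.
rewrite mulf_eq0 negb_or => /andP[f2x g2x].
by rewrite ef // eg // mulrACA -invfM.
Qed.

Lemma meromorphicD f g :
  meromorphic f -> meromorphic g -> meromorphic (fun x => f x + g x).
Proof.
move=> Hf Hg; apply: open_meromorphic => p.
have [f1 [f2 [U [oU Up HU]]]] := meromorphic_open p Hf.
have [g1 [g2 [V [oV Vp HV]]]] := meromorphic_open p Hg.
exists (fun x => f1 x * g2 x + g1 x * f2 x), (fun x => f2 x * g2 x), (U `&` V).
split=> [||x [Ux Vx]]; [exact: openI | by [] |].
have [hf1 hf2 cf ef] := HU x Ux; have [hg1 hg2 cg eg] := HV x Vx.
split; [by apply: holomorphicD; exact: holomorphicM | exact: holomorphicM | |].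
  have HfU y : (U `&` V) y -> holomorphic_at f2 y by move=> [/HU[]].
  have HgU y : (U `&` V) y -> closure [set z | g2 z != 0] y by move=> [_ /HV[]].
  exact: closure_nonvanishingM (openI oU oV) (conj Ux Vx) HfU cf HgU.
rewrite mulf_eq0 negb_or => /andP[f2x g2x].
by rewrite ef // eg // addf_div.
Qed.

Lemma meromorphic_sum (I : Type) (s : seq I) (P : pred I)
    (F : I -> 'rV[R[i]]_n.+1 -> R[i]) :
  (forall i, meromorphic (F i)) ->
  meromorphic (fun x => \sum_(i <- s | P i) F i x).
Proof.
move=> H; elim: s => [|i s IH].
  under eq_fun do rewrite big_nil; exact: meromorphic_cst.
under eq_fun do rewrite big_cons.
by case Pi: (P i) => //; apply: meromorphicD.
Qed.

Lemma meromorphic_prod (I : Type) (s : seq I) (P : pred I)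
    (F : I -> 'rV[R[i]]_n.+1 -> R[i]) :
  (forall i, P i -> meromorphic (F i)) ->
  meromorphic (fun x => \prod_(i <- s | P i) F i x).
Proof.
move=> H; elim: s => [|i s IH].
  under eq_fun do rewrite big_nil; exact: meromorphic_cst.
under eq_fun do rewrite big_cons.
by case Pi: (P i) => //; apply: meromorphicM => //; exact: H.
Qed.

Lemma meromorphic_translate v f :
  meromorphic f -> meromorphic (fun x => f (x + v)).
Proof.
move=> Hf; apply: open_meromorphic => p.
have [f1 [f2 [U [oU Up HU]]]] := meromorphic_open (p + v) Hf.
exists (fun x => f1 (x + v)), (fun x => f2 (x + v)), [set x | U (x + v)].
split=> [||x /= Ux]; [exact: open_translate | by [] |].
have [hf1 hf2 cf ef] := HU _ Ux.
split; [exact: holomorphic_translate | exact: holomorphic_translate | |exact: ef].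
move=> B /(@nbhs_interior 'rV[R[i]]_n.+1 x) nB.
have oB' := open_interior B; have B'x : interior B x by exact: nbhs_singleton nB.
have sB := @interior_subset _ B.
have [|z [/= hz Bz]] := cf [set z | interior B (z - v)].
  by apply: open_nbhs_nbhs; split; [exact: open_translate | rewrite /= addrK].
by exists (z - v); split; rewrite /= ?subrK //; exact: sB.
Qed.

End Meromorphic.

(** * Quantum numbers and lattice coordinates *)

Section QuantumNumbers.
Variables (R : realType) (l : R[i]).
Implicit Types a b : R[i].

Lemma qpowD a b : qpow l (a + b) = qpow l a * qpow l b.
Proof. by rewrite /qpow mulrDl cexpD. Qed.

Lemma qpow0 : qpow l 0 = 1.
Proof. by rewrite /qpow mul0r cexp0. Qed.

Lemma qpow_neq0 a : qpow l a != 0.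
Proof. exact: cexp_neq0. Qed.

Lemma qpowN a : qpow l (- a) = (qpow l a)^-1.
Proof.
apply: (mulfI (qpow_neq0 a)); rewrite -qpowD subrr qpow0 mulfV //.
exact: qpow_neq0.
Qed.

Lemma qpowB a b : qpow l (a - b) = qpow l a / qpow l b.
Proof. by rewrite qpowD qpowN. Qed.

Lemma qpow_mulrn a k : qpow l (a *+ k) = qpow l a ^+ k.
Proof. by elim: k => [|k IH]; rewrite ?qpow0 // mulrS exprS qpowD IH. Qed.

Lemma qbrN a : qbr l (- a) = - qbr l a.
Proof. by rewrite /qbr opprK opprB. Qed.

Lemma qbrE a : qbr l a = qpow l (- a) * (qpow l (2 * a) - 1).
Proof. by rewrite mulrBr mulr1 -qpowD /qbr; congr (qpow l _ - _); ring. Qed.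

Lemma qbr_eq0 a : (qbr l a == 0) = (qpow l (2 * a) == 1).
Proof.
by rewrite qbrE mulf_eq0 (negPf (qpow_neq0 _)) /= subr_eq0.
Qed.

(** The product-to-sum formula that turns differences of the values
    [q^a + q^-a] into products of quantum numbers. *)
Lemma qpow_sumB a b : (qpow l a + qpow l (- a)) - (qpow l b + qpow l (- b)) =
  qbr l ((a - b) / 2) * qbr l ((a + b) / 2).
Proof.
rewrite /qbr mulrBl !mulrBr -!qpowD.
rewrite (_ : (a - b) / 2 + (a + b) / 2 = a); last by field.
rewrite (_ : (a - b) / 2 - (a + b) / 2 = - b); last by field.
rewrite (_ : - ((a - b) / 2) + (a + b) / 2 = b); last by field.
rewrite (_ : - ((a - b) / 2) - (a + b) / 2 = - a); last by field.
by ring.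
Qed.

Hypothesis q_not_root : forall k, (0 < k)%N -> qpow l 1 ^+ k != 1.

Lemma qpow_int_eq1 (k : int) : (qpow l k%:~R == 1) = (k == 0).
Proof.
have H (j : nat) : qpow l j.+1%:R != 1 by rewrite qpow_mulrn q_not_root.
case: k => [[|j]|j]; first by rewrite qpow0 !eqxx.
- by rewrite (negPf (H j)).
- rewrite NegzE rmorphN qpowN invr_eq1 /= oppr_eq0.
  by rewrite [in LHS]/= (negPf (H j)).
Qed.

Lemma qbr_nat_neq0 (k : nat) : (0 < k)%N -> qbr l k%:R != 0.
Proof.
move=> k0; rewrite qbr_eq0 -natrM (qpow_int_eq1 (2 * k)%N%:Z).
by rewrite -lt0n in k0 *; case: k k0.
Qed.

Lemma log_neq0 : l != 0.
Proof.
apply/eqP => l0; have := q_not_root (ltn0Sn 0).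
by rewrite l0 /qpow mulr0 cexp0 expr1n eqxx.
Qed.

End QuantumNumbers.

Section Lattice.
Variables (R : realType) (n m : nat).
Hypothesis m_gt0 : (0 < m)%N.
Implicit Types (k : 'rV[int]_n.+1) (x z : 'rV[R[i]]_n.+1) (p r : 'I_n.+1).

(** Length and squared length of the [p]-th basis vector of the lattice. *)
Definition bnorm p : R := if p == ord_max then sqm R m else 1.
Definition bsq p : R[i] := if p == ord_max then m%:R else 1.

(** The pairing of [z] with the [p]-th basis vector of the lattice. *)
Definition lcoord p z : R[i] := (bnorm p)%:C * z ord0 p.

Definition lat k : 'rV[R]_n.+1 := \sum_p (k ord0 p)%:~R *: lat_basis R m p.

Lemma bnorm_neq0 p : bnorm p != 0.
Proof.
rewrite /bnorm; case: ifP => _; last exact: oner_neq0.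
by rewrite /sqm gt_eqF // sqrtr_gt0 ltr0n.
Qed.

Lemma bnorm_sqr p : (bnorm p)%:C * (bnorm p)%:C = bsq p.
Proof.
rewrite /bnorm /bsq; case: ifP => _; last by rewrite mulr1.
by rewrite -rmorphM -expr2 sqr_sqrtr ?ler0n // rmorph_nat.
Qed.

Lemma lat_basis_entry p r : lat_basis R m p ord0 r = (p == r)%:R * bnorm p.
Proof.
by rewrite /lat_basis !mxE eqxx /= (eq_sym r) mulrC.
Qed.

Lemma lat_entry k p : lat k ord0 p = (k ord0 p)%:~R * bnorm p.
Proof.
rewrite summxE (bigD1 p) //= big1 => [|r rp].
  by rewrite mxE lat_basis_entry eqxx mul1r addr0.
by rewrite mxE lat_basis_entry (negPf rp) mul0r mulr0.
Qed.

Lemma latD k k' : lat (k + k') = lat k + lat k'.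
Proof. by apply/rowP => p; rewrite !(mxE, lat_entry) intrD mulrDl. Qed.

Lemma lat0 : lat 0 = 0.
Proof. by apply/rowP => p; rewrite lat_entry !mxE mul0r. Qed.

Lemma lat_inj : injective lat.
Proof.
move=> k k' /rowP H; apply/rowP => p; have := H p; rewrite !lat_entry.
by move/(mulIf (bnorm_neq0 p))/intr_inj.
Qed.

Lemma lat_delta p : lat (delta_mx ord0 p) = lat_basis R m p.
Proof.
apply/rowP => r; rewrite lat_entry lat_basis_entry mxE eqxx /= (eq_sym r).
by case: (eqVneq p r) => [->|_]; rewrite //= !mul0r.
Qed.

Lemma latP_lat (v : 'rV[R]_n.+1) : latP m v <-> exists k, v = lat k.
Proof.
split=> [[k ->]|[k ->]]; last by exists (fun p => k ord0 p).
by exists (\row_p k p); apply: eq_bigr => p _; rewrite mxE.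
Qed.

Lemma lcoordD p x z : lcoord p (x + z) = lcoord p x + lcoord p z.
Proof. by rewrite /lcoord mxE mulrDr. Qed.

Lemma lcoordZ p a z : lcoord p (a *: z) = a * lcoord p z.
Proof. by rewrite /lcoord mxE mulrCA. Qed.

Lemma lcoord_lat p k : lcoord p (toC (lat k)) = bsq p * (k ord0 p)%:~R.
Proof.
by rewrite /lcoord mxE lat_entry mulrC rmorphM /= -mulrA bnorm_sqr mulrC rmorph_int.
Qed.

Lemma dotpDl x x' z : dotp (x + x') z = dotp x z + dotp x' z.
Proof. by rewrite -big_split; apply: eq_bigr => p _; rewrite mxE mulrDl. Qed.

Lemma dotpDr x z z' : dotp x (z + z') = dotp x z + dotp x z'.
Proof. by rewrite -big_split; apply: eq_bigr => p _; rewrite mxE mulrDr. Qed.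

Lemma dotpZr a x z : dotp x (a *: z) = a * dotp x z.
Proof. by rewrite mulr_sumr; apply: eq_bigr => p _; rewrite mxE mulrCA. Qed.

Lemma dotp_basis x p : dotp x (toC (lat_basis R m p)) = lcoord p x.
Proof.
rewrite /dotp (bigD1 p) //= big1 => [|r rp].
  by rewrite addr0 mxE lat_basis_entry eqxx mul1r mulrC.
by rewrite mxE lat_basis_entry eq_sym (negPf rp) mul0r rmorph0 mulr0.
Qed.

Lemma basis_dotp p z : dotp (toC (lat_basis R m p)) z = lcoord p z.
Proof. by rewrite -dotp_basis; apply: eq_bigr => r _; rewrite mulrC. Qed.

Lemma dotp_lat k z :
  dotp (toC (lat k)) z = \sum_p (k ord0 p)%:~R * lcoord p z.
Proof.
apply: eq_bigr => p _.
by rewrite mxE lat_entry /lcoord rmorphM /= rmorph_int mulrA.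
Qed.

Lemma toCD (u v : 'rV[R]_n.+1) : toC (u + v) = toC u + toC v.
Proof. exact: map_mxD. Qed.

Lemma toCZ (a : R) (v : 'rV[R]_n.+1) : toC (a *: v) = a%:C *: toC v.
Proof. exact: map_mxZ. Qed.

Lemma holomorphic_lcoord p x : holomorphic_at (lcoord p) x.
Proof.
apply: holomorphicM; [exact: holomorphic_cst | exact: holomorphic_coord].
Qed.

End Lattice.

Section GenericNonvanishing.
Variables (R : realType) (n m : nat) (l : R[i]).
Hypothesis m_gt0 : (0 < m)%N.
Hypothesis q_not_root : forall k, (0 < k)%N -> qpow l 1 ^+ k != 1.
Implicit Types (x : 'rV[R[i]]_n.+1) (p r : 'I_n.+1) (c : R[i]).

Lemma holomorphic_qbr (f : 'rV[R[i]]_n.+1 -> R[i]) x :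
  holomorphic_at f x -> holomorphic_at (fun y => qbr l (f y)) x.
Proof.
move=> hf; apply: holomorphicB; apply: holomorphic_cexp;
  apply: holomorphicM; try exact: holomorphic_cst; first exact: hf.
rewrite (_ : (fun y => - f y) = fun y => 0 - f y).
  by apply: holomorphicB => //; exact: holomorphic_cst.
by apply/funext => y; rewrite sub0r.
Qed.

(** A zero of the function is left by moving [x] in the [p]-th direction by a
    small step [t] for which [q] to the power twice the increment of the
    argument is a real number larger than 1. *)
Lemma generically_qbr p r c : p != r ->
  generically (fun x => qbr l (lcoord m p x - lcoord m r x + c) != 0).
Proof.
move=> pr; pose F x := qbr l (lcoord m p x - lcoord m r x + c).
have hF x : holomorphic_at F x.
  apply: holomorphic_qbr; apply: holomorphicD; last exact: holomorphic_cst.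
  by apply: holomorphicB; exact: holomorphic_lcoord.
exists [set x | F x != 0]; split=> //.
  rewrite openE => x Fx; exact: nonvanishing_nbhs.
move=> O [x Ox] oO; have [Fx|] := boolP (F x != 0); first by exists x.
rewrite negbK => /eqP Fx0.
pose v : 'rV[R[i]]_n.+1 := delta_mx ord0 p.
have ct : {for 0, continuous (fun t : R[i] => x + t *: v)}.
  apply: differentiable_continuous; apply: differentiableD; first exact: differentiable_cst.
  by apply: differentiableZl; exact: ex_diff.
have : nbhs (0 : R[i]) [set t : R[i] | O (x + t *: v)].
  by apply: ct; rewrite scale0r addr0; exact: open_nbhs_nbhs.
move=> /nbhs_ballP[e /= e0 He].
pose w : R[i] := 2 * (bnorm R m p)%:C * l.
have w0 : w != 0.
  rewrite /w !mulf_neq0 ?pnatr_eq0 // ?(log_neq0 q_not_root) //.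
  by rewrite fmorph_eq0 bnorm_neq0.
case: e e0 He => e ei; rewrite ltcE /= => /andP[/eqP -> e0] He.
have [wr wrE] : exists wr, `|w| = wr%:C by rewrite normc_def; eexists.
have wr0 : 0 < wr by rewrite -ltcR -wrE normr_gt0.
pose s := e * wr / 2; have s0 : 0 < s by rewrite divr_gt0 // mulr_gt0.
pose t : R[i] := s%:C / w; exists (x + t *: v); split.
  apply: He; rewrite /ball /= sub0r normrN normf_div wrE ger0_norm ?ler0c ?ltW //.
  rewrite ltr_pdivrMr ?ltcR // [X in _ < X](_ : _ = (e * wr)%:C); last by rewrite rmorphM.
  rewrite ltcR /s ltr_pdivrMr // ltr_pMr ?ltr1n //.
  by rewrite mulr_gt0.
have lp : lcoord m p (x + t *: v) = lcoord m p x + (bnorm R m p)%:C * t.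
  by rewrite lcoordD /lcoord !mxE !eqxx mulr1.
have lr : lcoord m r (x + t *: v) = lcoord m r x.
  rewrite lcoordD [X in _ + X](_ : _ = 0) ?addr0 // /lcoord !mxE.
  by rewrite eqxx eq_sym (negPf pr) !mulr0.
rewrite /= /F lp lr qbr_eq0; move: Fx0 => /eqP; rewrite /F qbr_eq0 => /eqP q1.
rewrite (_ : 2 * _ = 2 * (lcoord m p x - lcoord m r x + c) +
  2 * (bnorm R m p)%:C * t); last by ring.
rewrite qpowD q1 mul1r /qpow (_ : _ * t * l = s%:C); last first.
  by rewrite mulrAC -/w mulrC divfK.
rewrite eq_complex /= cos0 sin0 mulr0 mulr1 eqxx andbT.
by rewrite -expR0 (inj_eq (@expR_inj R)) gt_eqF.
Qed.

End GenericNonvanishing.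

(** * Strings of lattice points and the polytope *)

Section IntegerVectors.
Variable n : nat.
Implicit Types (k v w : 'rV[int]_n.+1) (p r i : 'I_n.+1).

(** The root that is the difference of the [p]-th and the [r]-th basis vector
    of the lattice, in coordinates with respect to this basis. *)
Definition rt p r : 'rV[int]_n.+1 := delta_mx ord0 p - delta_mx ord0 r.

Lemma rtE p r i : rt p r ord0 i = (i == p)%:Z - (i == r)%:Z.
Proof. by rewrite !mxE eqxx /= !natz. Qed.

Lemma string_head w t p r : (p < r)%N -> (w + t *: rt p r) ord0 p = w ord0 p + t.
Proof.
move=> pr; rewrite mxE [X in _ + X]mxE rtE eqxx (_ : (p == r) = false).
  by rewrite subr0 mulr1.
by apply/negbTE; rewrite -val_eqE /= ltn_eqF.
Qed.

Lemma string_tail w t p r : (p < r)%N -> (w + t *: rt p r) ord0 r = w ord0 r - t.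
Proof.
move=> pr; rewrite mxE [X in _ + X]mxE rtE eqxx (_ : (r == p) = false).
  by rewrite sub0r mulrN1.
by apply/negbTE; rewrite -val_eqE /= gtn_eqF.
Qed.

Lemma string_other w t p r i :
  i != p -> i != r -> (w + t *: rt p r) ord0 i = w ord0 i.
Proof.
move=> /negPf ip /negPf ir.
by rewrite mxE [X in _ + X]mxE rtE ip ir subrr mulr0 addr0.
Qed.

(** Exponents are eliminated in this order.  It is compatible with addition,
    and positive roots point to earlier vectors. *)
Definition colex k v : bool :=
  [exists p : 'I_n.+1, (k ord0 p < v ord0 p) &&
    [forall r : 'I_n.+1, (p < r)%N ==> (k ord0 r == v ord0 r)]].

Lemma colexP k v : reflect (exists2 p, k ord0 p < v ord0 p &
    forall r : 'I_n.+1, (p < r)%N -> k ord0 r = v ord0 r) (colex k v).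
Proof.
apply: (iffP existsP) => [[p /andP[kp /forallP H]]|[p kp H]]; exists p => //.
  by move=> r pr; apply/eqP; exact: (implyP (H r)).
by rewrite kp; apply/forallP => r; apply/implyP => /H ->.
Qed.

Lemma colex_irr k : colex k k = false.
Proof. by apply/colexP => -[p]; rewrite ltxx. Qed.

Lemma colex_trans : transitive colex.
Proof.
move=> v k w /colexP[p kp Hp] /colexP[r vr Hr]; apply/colexP.
case: (ltngtP p r) => pr.
- by exists r => [|i ri]; [rewrite Hp | rewrite Hp ?Hr // (ltn_trans pr)].
- by exists p => [|i pi]; [rewrite -Hr | rewrite Hp ?Hr // (ltn_trans pr)].
- move: (val_inj pr) => {}pr; subst r; exists p => [|i pi].
    exact: lt_trans kp vr.
  by rewrite Hp ?Hr.
Qed.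

Lemma colex_total k v : k != v -> colex k v || colex v k.
Proof.
move=> kv; have [p0 p0P] : exists p, k ord0 p != v ord0 p.
  case: (pickP (fun p => k ord0 p != v ord0 p)) => [p|H]; first by exists p.
  case/eqP: kv; apply/rowP => p; apply/eqP; have := H p.
  by move/negbFE.
pose p := [arg max_(p > p0 | k ord0 p != v ord0 p) p].
have [kp Hp] : k ord0 p != v ord0 p /\
    forall r, k ord0 r != v ord0 r -> (r <= p)%N.
  by rewrite /p; case: arg_maxnP.
have E r : (p < r)%N -> k ord0 r = v ord0 r.
  by move=> pr; apply/eqP/negPn/negP => /Hp; rewrite leqNgt pr.
case: (ltgtP (k ord0 p) (v ord0 p)) kp => // kp _; apply/orP.
- by left; apply/colexP; exists p.
- by right; apply/colexP; exists p => // r /E.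
Qed.

Lemma colexD2l k v w : colex (w + k) (w + v) = colex k v.
Proof.
apply/colexP/colexP => -[p kp H]; exists p.
- by move: kp; rewrite !mxE ltrD2l.
- by move=> r /H; rewrite !mxE => /addrI.
- by rewrite !mxE ltrD2l.
- by move=> r /H; rewrite !mxE => ->.
Qed.

Lemma colex_first (s : seq 'rV[int]_n.+1) : s != [::] ->
  exists2 k, k \in s & forall v, v \in s -> v != k -> colex k v.
Proof.
elim: s => // k s IH _; have [->|/IH[w ws H]] := eqVneq s [::].
  by exists k; rewrite ?mem_head // => v; rewrite inE => ->.
have [kw|kw] := boolP ((k == w) || colex w k).
  exists w; first by rewrite inE ws orbT.
  move=> v; rewrite inE => /orP[/eqP ->|/H//].
  by case/orP: kw => [/eqP ->|//]; rewrite eqxx.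
move: kw; rewrite negb_or => /andP[kw /negPf wk].
have := colex_total kw; rewrite wk orbF => {}kw.
exists k; rewrite ?mem_head // => v; rewrite inE => /orP[/eqP ->|vs _].
  by rewrite eqxx.
by have [->//|/(H _ vs)] := eqVneq v w; exact: colex_trans.
Qed.

Definition box (L : nat) : seq 'rV[int]_n.+1 :=
  undup [seq \row_p ((f p : nat)%:Z - L%:Z) | f : {ffun 'I_n.+1 -> 'I_(L.*2.+1)}].

Lemma mem_box L k : (forall p, `|k ord0 p| <= L%:Z) -> k \in box L.
Proof.
move=> H; rewrite mem_undup; apply/mapP.
exists [ffun p => inord (absz (k ord0 p + L%:Z))]; first by rewrite mem_enum.
apply/rowP => p; rewrite mxE ffunE; have := H p => Hp.
rewrite inordK; move: Hp; set a := k _ _ => Hp; lia.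
Qed.

Lemma bounded_enum (P : 'rV[int]_n.+1 -> bool) (L : nat) :
  (forall k p, P k -> `|k ord0 p| <= L%:Z) ->
  exists2 s, uniq s & forall k, (k \in s) = P k.
Proof.
move=> H; exists [seq k <- box L | P k]; first by rewrite filter_uniq // undup_uniq.
move=> k; rewrite mem_filter; case Pk: (P k) => //=.
by apply: mem_box => p; exact: H.
Qed.

Lemma Posz_sum (I : finType) (P : pred I) (F : I -> nat) :
  (\sum_(i | P i) F i)%N%:Z = \sum_(i | P i) (F i)%:Z.
Proof. exact: (big_morph Posz PoszD (erefl 0%:Z)). Qed.

Definition vsum k : int := \sum_p k ord0 p.

Lemma vsumB k v : vsum (k - v) = vsum k - vsum v.
Proof. by rewrite /vsum -sumrB; apply: eq_bigr => p _; rewrite !mxE. Qed.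

Lemma vsum_delta p : vsum (delta_mx ord0 p) = 1.
Proof.
rewrite /vsum (bigD1 p) //= big1 => [|r rp]; rewrite mxE !eqxx //=.
by rewrite (negPf rp).
Qed.

Variable M : 'I_n.+1 -> 'I_n.+1 -> nat.

Definition up i : nat := \sum_(p < n.+1 | (i < p)%N) M i p.
Definition down i : nat := \sum_(p < n.+1 | (p < i)%N) M p i.

(** The heart of the elimination: below the colex-first element [mu] of a set
    with long strings there is room for a whole polytope.  Applying the roots
    [rt i p], [p = i+1, i+2, ...], in this order, one never leaves the part of
    [S] on which the coordinates after [p] agree with those of [mu]; there the
    [p]-th coordinate is smallest at [mu], which forces the strings in the
    direction [rt i p] downwards. *)
Lemma string_room (S : 'rV[int]_n.+1 -> Prop) (mu : 'rV[int]_n.+1) (i : 'I_n.+1) :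
  (forall w p r, S w -> (p < r)%N ->
     (forall t : int, S (w + t *: rt p r) -> t <= 0) ->
     exists2 t : int, t <= - (M p r)%:Z & S (w + t *: rt p r)) ->
  S mu -> (forall v, S v -> ~~ colex v mu) ->
  exists2 v, S v & v ord0 i <= mu ord0 i - (up i)%:Z.
Proof.
move=> string Smu mu_min.
have claim j : (i < j <= n.+1)%N -> exists v, [/\ S v,
    forall p : 'I_n.+1, (j <= p)%N -> v ord0 p = mu ord0 p &
    v ord0 i <= mu ord0 i -
      (\sum_(p < n.+1 | (i < p)%N && (p < j)%N) M i p)%N%:Z].
  elim: j => // j IH /andP[]; rewrite ltnS leq_eqVlt => /orP[/eqP ij|ij] jn.
    exists mu; split=> //; rewrite big1 ?subr0 // => p.
    by rewrite ltnS -ij; lia.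
  have [|w [Sw Hw wi]] := IH; first by rewrite ij ltnW.
  pose J := Ordinal jn.
  have iJ : (i < J)%N by [].
  have later t (r : 'I_n.+1) : (j < r)%N -> (w + t *: rt i J) ord0 r = mu ord0 r.
    move=> jr; rewrite string_other ?Hw ?(ltnW jr) // -val_eqE /= gtn_eqF //.
    exact: ltn_trans ij jr.
  have [|t tM St] := string w i J Sw ij.
    move=> t St; rewrite leNgt; apply/negP => t0.
    have /negP := mu_min _ St; apply; apply/colexP; exists J => [|r /later //].
    by rewrite string_tail // Hw // gtrBl.
  exists (w + t *: rt i J); split=> //; first by move=> r /later.
  rewrite string_head // (bigD1 J) /=; last by rewrite ij ltnSn.
  rewrite (eq_bigl (fun p : 'I_n.+1 => (i < p)%N && (p < j)%N)); last first.
    by move=> p; rewrite -val_eqE /= ltnS; case: (ltngtP p j); rewrite ?andbT ?andbF.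
  by rewrite PoszD opprD addrCA addrC lerD.
have [|v [Sv _ vi]] := claim n.+1; first by rewrite ltn_ord leqnn.
exists v => //; apply: le_trans vi _; rewrite lerD2l lerN2 lez_nat.
by rewrite (eq_bigl (fun p : 'I_n.+1 => (i < p)%N)) // => p; rewrite ltn_ord andbT.
Qed.

(** Lattice points of the support, relative to its top vertex.  Any set of
    coordinates [A] bounds the polytope, the bound being the total
    multiplicity of the positive roots along which the [A]-sum decreases. *)
Definition in_support k : Prop := vsum k = 0 /\
  forall A : 'I_n.+1 -> bool, \sum_(p | A p) k ord0 p <=
    (\sum_(p | ~~ A p) \sum_(r | A r && (p < r)%N) M p r)%N%:Z.

Lemma in_support_ge k p : in_support k -> - (up p)%:Z <= k ord0 p.
Proof.
move=> [s0 /(_ (fun r => r != p))].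
have -> : \sum_(r | r != p) k ord0 r = - k ord0 p.
  have := s0; rewrite /vsum (bigD1 p) //= => /eqP.
  by rewrite addrC addr_eq0 => /eqP.
rewrite (big_pred1 p) => [|r]; last by rewrite negbK.
move=> H; rewrite lerNl; apply: le_trans H _; rewrite lez_nat /up.
rewrite leq_eqVlt; apply/orP; left; apply/eqP; apply: eq_bigl => r.
by rewrite -val_eqE /=; case: ltngtP.
Qed.

Lemma in_support_le k i : in_support k -> k ord0 i <= (down i)%:Z.
Proof.
move=> [_ /(_ (pred1 i))]; rewrite big_pred1_eq => H; apply: le_trans H _.
rewrite lez_nat /down big_mkcond [leqRHS]big_mkcond; apply: leq_sum => p _ /=.
by case: eqVneq => //= pi; rewrite big_mkcondr /= big_pred1_eq.
Qed.

Lemma in_support_bounded k p : in_support k -> `|k ord0 p| <= (up p + down p)%N%:Z.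
Proof.
by move=> Nk; have := in_support_ge p Nk; have := in_support_le p Nk; lia.
Qed.

(** The sum of the coordinates from any [p] on is non-negative on the
    polytope, so the last non-zero coordinate of a point is positive. *)
Lemma in_support_first k : in_support k -> ~~ colex k 0.
Proof.
move=> [s0 H]; apply/negP => /colexP[p kp Hp].
rewrite mxE in kp.
have := H (fun r : 'I_n.+1 => (r < p)%N); apply/negP; rewrite -ltNge.
rewrite (eq_bigr (fun=> 0%N)) => [|r]; last first.
  rewrite -leqNgt => pr; rewrite big1 // => r' /andP[r'p].
  by rewrite ltnNge (leq_trans (ltnW r'p) pr).
suff E : \sum_(r < n.+1 | (r < p)%N) k ord0 r + k ord0 p = 0.
  by rewrite big1_eq -(ltrD2r (k ord0 p)) add0r E.
rewrite -[RHS]s0 /vsum [RHS](bigID (fun r : 'I_n.+1 => (r < p)%N)) /=.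
congr (_ + _); rewrite (bigD1 p) ?ltnn //= big1 ?addr0 // => r /andP[pr rp].
by rewrite Hp ?mxE // ltn_neqAle leqNgt pr eq_sym rp.
Qed.

(** The path along edges of the polytope from its top vertex to the vertex
    where the [i]-th coordinate is largest: [edge_vertex i j] has passed the
    roots [rt p i] with [j <= p < i], taken in decreasing order of [p]. *)
Definition edge_vertex (i : 'I_n.+1) (j : nat) : 'rV[int]_n.+1 :=
  \row_p (if p == i then (\sum_(r < n.+1 | (j <= r < i)%N) M r i)%N%:Z
          else if (j <= p < i)%N then - (M p i)%:Z else 0).

Lemma edge_vertex_top i : edge_vertex i i = 0.
Proof.
apply/rowP => p; rewrite !mxE; case: eqP => _.
  by rewrite big1 // => r; rewrite -ltnS => /andP[]; lia.
by case: ifP => //; rewrite -ltnS => /andP[]; lia.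
Qed.

Lemma edge_vertex_step (i J : 'I_n.+1) : (J < i)%N ->
  edge_vertex i J = edge_vertex i J.+1 + (- (M J i)%:Z) *: rt J i.
Proof.
move=> Ji; apply/rowP => p.
have [->|pJ] := eqVneq p J.
  by rewrite string_head // !mxE -val_eqE /= ltn_eqF // leqnn Ji ltnn /= add0r.
have [->|pi] := eqVneq p i.
  rewrite string_tail // !mxE eqxx opprK (bigD1 J) /= ?leqnn ?Ji // addnC PoszD.
  congr (_%:Z + _); apply: eq_bigl => r.
  by rewrite -val_eqE /=; case: (ltngtP J r); rewrite ?andbT ?andbF.
rewrite string_other // !mxE (negPf pi).
by move: pJ; rewrite -val_eqE /= eq_sym; case: (ltngtP J p).
Qed.

(** The two ends are cut out by two instances of [in_support]: for the set of
    the coordinates up to [J], and for the set consisting of [i] and the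
    coordinates before [J]. *)
Lemma edge_vertex_segment (i J : 'I_n.+1) (t : int) : (J < i)%N ->
  in_support (edge_vertex i J.+1 + t *: rt J i) -> - (M J i)%:Z <= t <= 0.
Proof.
move=> Ji [_ H]; set v := edge_vertex _ _ + _ in H.
have v_small (p : 'I_n.+1) : (p < J)%N -> v ord0 p = 0.
  move=> pJ; have pi := ltn_trans pJ Ji.
  rewrite /v string_other -?val_eqE /= ?ltn_eqF // mxE -val_eqE /= ltn_eqF //.
  by rewrite ltnNge ltnW.
have vJ : v ord0 J = t.
  by rewrite /v string_head // mxE -val_eqE /= ltn_eqF // ltnn add0r.
have vi : v ord0 i = (\sum_(r < n.+1 | (J < r < i)%N) M r i)%N%:Z - t.
  by rewrite /v string_tail // mxE eqxx.
apply/andP; split; last first.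
  have := H (fun p : 'I_n.+1 => (p <= J)%N).
  rewrite (bigD1 J) ?leqnn //= big1 ?addr0 ?vJ => [|p /andP[pJ pJ']]; last first.
    by rewrite v_small // ltn_neqAle pJ' pJ.
  move=> tH; apply: le_trans tH _; rewrite big1 // => p; rewrite -ltnNge => Jp.
  by rewrite big1 // => r /andP[rJ]; rewrite ltnNge (leq_trans rJ) // ltnW.
have := H (fun p : 'I_n.+1 => (p == i) || (p < J)%N).
rewrite (bigD1 i) ?eqxx //= big1 ?addr0 ?vi => [|p]; last first.
  by case/andP=> /orP[/eqP ->|pJ _]; [rewrite eqxx | exact: v_small].
have bound : (\sum_(p | ~~ [|| p == i | p < J]) \sum_(r | [|| r == i | r < J] && (p < r)) M p r
  <= M J i + \sum_(r < n.+1 | J < r < i) M r i)%N.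
  rewrite [leqRHS](_ : _ = \sum_(r < n.+1 | J <= r < i) M r i)%N; last first.
    rewrite [RHS](bigD1 J) /= ?leqnn ?Ji //; congr addn; apply: eq_bigl => r.
    by rewrite -val_eqE /=; case: (ltngtP J r); rewrite ?andbT ?andbF.
  rewrite [leqLHS]big_mkcond [leqRHS]big_mkcond /=; apply: leq_sum => p _.
  case: ifP => //; rewrite negb_or -leqNgt => /andP[pi Jp].
  rewrite Jp /= [leqRHS](_ : _ = \sum_(r | (r == i) && (p < r)) M p r)%N; last first.
    by rewrite big_mkcondr /= big_pred1_eq.
  rewrite leq_eqVlt; apply/orP; left; apply/eqP; apply: eq_bigl => r.
  case: eqVneq => //= ri; apply/negP => /andP[rJ pr].
  by move: (ltn_trans pr rJ); rewrite ltnNge Jp.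
move: bound; rewrite -lez_nat PoszD => bound tH.
by have := le_trans tH bound; rewrite addrC lerD2r lerNl.
Qed.

End IntegerVectors.

(** * Linear independence of exponentials *)

Section Independence.

Lemma sum_same_support (V : nmodType) (I : eqType) (s1 s2 : seq I) (F : I -> V) :
  uniq s1 -> uniq s2 -> (forall i, F i != 0 -> (i \in s1) = (i \in s2)) ->
  \sum_(i <- s1) F i = \sum_(i <- s2) F i.
Proof.
move=> u1 u2 H.
rewrite (bigID (fun i => F i != 0)) /= [X in _ + X]big1 => [|i /negPn/eqP //].
rewrite [RHS](bigID (fun i => F i != 0)) /= [X in _ = _ + X]big1 => [|i /negPn/eqP //].
rewrite !addr0 -big_filter -[RHS]big_filter; apply: perm_big; apply: uniq_perm.
- exact: filter_uniq.
- exact: filter_uniq.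
- by move=> i; rewrite !mem_filter; case Fi: (F i != 0); rewrite //= H.
Qed.

(** Linear independence of characters: applying a relation at [v + w] and
    subtracting a multiple of it at [v] removes one of the characters. *)
Lemma characters_independent (F : fieldType) (V : zmodType) (I : eqType)
    (chi : I -> V -> F) (s : seq I) (c : I -> F) :
  (forall i u v, chi i (u + v) = chi i u * chi i v) ->
  (forall i, chi i 0 = 1) ->
  (forall i j, i != j -> exists v, chi i v != chi j v) -> uniq s ->
  (forall v, \sum_(i <- s) c i * chi i v = 0) ->
  forall i, i \in s -> c i = 0.
Proof.
move=> chiD chi0 chi_neq; elim: s c => // j s IH c /andP[js us] H.
have Hs i : i \in s -> c i = 0.
  move=> si; have ij : i != j by apply: contraNneq js => <-.
  have [w Hw] := chi_neq i j ij.
  have /eqP : c i * (chi i w - chi j w) = 0.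
    apply: (IH (fun t => c t * (chi t w - chi j w)) us _ i si) => v.
    have := H (v + w); have := H v; rewrite !big_cons chiD => H1 H2.
    have -> : \sum_(t <- s) c t * (chi t w - chi j w) * chi t v =
        \sum_(t <- s) c t * chi t (v + w) - (\sum_(t <- s) c t * chi t v) * chi j w.
      by rewrite mulr_suml -sumrB; apply: eq_bigr => t _; rewrite chiD; ring.
    move/eqP: H1; rewrite addrC addr_eq0 => /eqP ->.
    by move/eqP: H2; rewrite addrC addr_eq0 => /eqP ->; ring.
  by rewrite mulf_eq0 subr_eq0 (negPf Hw) orbF => /eqP.
move=> i; rewrite inE => /orP[/eqP ->|/Hs //].
have := H 0; rewrite big_cons chi0 mulr1 big_seq big1 ?addr0 // => t /Hs ->.
by rewrite mul0r.
Qed.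

Lemma sum_fibres (V : nmodType) (I J : eqType) (f : I -> J) (s : seq I) (F : I -> V) :
  \sum_(i <- s) F i = \sum_(j <- undup (map f s)) \sum_(i <- s | f i == j) F i.
Proof.
rewrite (exchange_big_dep xpredT) //= big_seq [RHS]big_seq; apply: eq_bigr => i si.
rewrite big_mkcond (bigD1_seq (f i)) ?undup_uniq //=; last by rewrite mem_undup map_f.
by rewrite eqxx big1 ?addr0 // => t /negPf ti; rewrite eq_sym ti.
Qed.

Lemma characters_grouped (F : fieldType) (V : zmodType) (I J : eqType)
    (chi : J -> V -> F) (f : I -> J) (s : seq I) (c : I -> F) :
  (forall i u v, chi i (u + v) = chi i u * chi i v) ->
  (forall i, chi i 0 = 1) ->
  (forall i j, i != j -> exists v, chi i v != chi j v) ->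
  (forall v, \sum_(i <- s) c i * chi (f i) v = 0) ->
  forall j, \sum_(i <- s | f i == j) c i = 0.
Proof.
move=> chiD chi0 chi_neq H j; have [js|js] := boolP (j \in map f s); last first.
  rewrite big_seq_cond big1 // => i /andP[si /eqP fi].
  by case/negP: js; rewrite -fi map_f.
apply: (characters_independent chiD chi0 chi_neq (undup_uniq (map f s))
  (c := fun j => \sum_(i <- s | f i == j) c i)); last by rewrite mem_undup.
move=> v; rewrite -[RHS](H v) [RHS](sum_fibres f); apply: eq_bigr => i _.
by rewrite mulr_suml; apply: eq_bigr => t /eqP ->.
Qed.

End Independence.

Section Exponentials.
Variables (R : realType) (n m : nat) (l : R[i]).
Hypothesis m_gt0 : (0 < m)%N.
Hypothesis q_not_root : forall k, (0 < k)%N -> qpow l 1 ^+ k != 1.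
Local Notation C := R[i].
Implicit Types (k w : 'rV[int]_n.+1) (x z y xi : 'rV[R[i]]_n.+1) (p r : 'I_n.+1).

(** The exponential with which the exponent [k] contributes to a
    Baker-Akhiezer function with spectral variable [xi]. *)
Definition wave xi k z : C := qpow l (2 * dotp (xi + toC (lat R m k)) z).

Definition mono k y : C := qpow l (2 * \sum_p (k ord0 p)%:~R * y ord0 p).

Lemma monoD k u v : mono k (u + v) = mono k u * mono k v.
Proof.
rewrite -qpowD -mulrDr -big_split; congr (qpow l (2 * _)).
by apply: eq_bigr => p _; rewrite mxE mulrDr.
Qed.

Lemma mono0 k : mono k 0 = 1.
Proof. by rewrite /mono big1 ?mulr0 ?qpow0 // => p _; rewrite mxE mulr0. Qed.

(** The value at a basis vector is an even power of [q]; here it matters that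
    [q] is not a root of unity. *)
Lemma mono_neq k w : k != w -> exists y, mono k y != mono w y.
Proof.
move=> kw; have [p kp] : exists p, k ord0 p != w ord0 p.
  case: (pickP (fun p => k ord0 p != w ord0 p)) => [p|H]; first by exists p.
  by case/eqP: kw; apply/rowP => p; apply/eqP; have /negbFE := H p.
have E v : mono v (delta_mx ord0 p) = qpow l (2 * v ord0 p)%:~R.
  rewrite /mono (bigD1 p) //= big1 => [|r rp].
    by rewrite mxE !eqxx mulr1 addr0 intrM.
  by rewrite mxE eqxx (negPf rp) mulr0.
exists (delta_mx ord0 p); rewrite !E -subr_eq0.
rewrite (_ : 2 * k ord0 p = 2 * (k ord0 p - w ord0 p) + 2 * w ord0 p); last first.
  by rewrite -mulrDr subrK.
rewrite intrD qpowD -[X in _ - X]mul1r.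
rewrite -mulrBl mulf_neq0 ?qpow_neq0 // subr_eq0 qpow_int_eq1 //.
by rewrite mulf_neq0 // subr_eq0.
Qed.

(** Every system of values of the [lcoord] is taken at some point. *)
Definition of_lcoord (y : 'rV[C]_n.+1) : 'rV[C]_n.+1 :=
  \row_p (y ord0 p / (bnorm R m p)%:C).

Lemma of_lcoordK y p : lcoord m p (of_lcoord y) = y ord0 p.
Proof. by rewrite /lcoord mxE mulrC divfK // fmorph_eq0 bnorm_neq0. Qed.

Lemma waveE xi k z : wave xi k z =
  qpow l (2 * dotp xi z) * qpow l (2 * \sum_p (k ord0 p)%:~R * lcoord m p z).
Proof. by rewrite /wave dotpDl mulrDr qpowD dotp_lat. Qed.

Lemma wave_of_lcoord xi k y : wave xi k (of_lcoord y) =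
  qpow l (2 * dotp xi (of_lcoord y)) * mono k y.
Proof.
by rewrite waveE; congr (_ * qpow l (2 * _)); apply: eq_bigr => p _; rewrite of_lcoordK.
Qed.

Lemma wave_translate xi k w z : wave (xi + toC (lat R m w)) k z = wave xi (k + w) z.
Proof. by rewrite /wave latD toCD addrA (addrAC xi). Qed.

Lemma wave_mul xi k w z :
  qpow l (2 * dotp (toC (lat R m w)) z) * wave xi k z = wave xi (k + w) z.
Proof. by rewrite -qpowD -mulrDr -dotpDl /wave latD toCD addrC addrA. Qed.

Lemma wave_shift xi k z p (j : nat) :
  wave xi k (z + toC (j%:R *: lat_basis R m p)) = wave xi k z *
    qpow l (2 * j%:R * lcoord m p (xi + toC (lat R m k))).
Proof.
rewrite /wave toCZ dotpDr dotpZr dotp_basis mulrDr qpowD rmorph_nat.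
by congr (_ * qpow l _); rewrite mulrA.
Qed.

Lemma waves_grouped (I : eqType) xi (f : I -> 'rV[int]_n.+1) (s : seq I) (c : I -> C) :
  (forall z, \sum_(i <- s) c i * wave xi (f i) z = 0) ->
  forall k, \sum_(i <- s | f i == k) c i = 0.
Proof.
move=> H; apply: (characters_grouped monoD mono0 mono_neq) => y.
apply: (mulfI (qpow_neq0 l (2 * dotp xi (of_lcoord y)))).
rewrite mulr0 -[RHS](H (of_lcoord y)) mulr_sumr; apply: eq_bigr => i _.
by rewrite wave_of_lcoord mulrCA.
Qed.

Lemma waves_independent xi (s : seq 'rV[int]_n.+1) (c : 'rV[int]_n.+1 -> C) :
  uniq s -> (forall z, \sum_(k <- s) c k * wave xi k z = 0) ->
  forall k, k \in s -> c k = 0.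
Proof.
move=> us H k ks; rewrite -[RHS](waves_grouped (f := id) H k) /=.
by rewrite -big_filter filter_pred1_uniq // big_seq1.
Qed.

End Exponentials.

(** * Relations along strings *)

Section Strings.
Variables (R : realType) (n m : nat) (l : R[i]).
Hypothesis m_gt0 : (0 < m)%N.
Hypothesis q_not_root : forall k, (0 < k)%N -> qpow l 1 ^+ k != 1.
Local Notation C := R[i].
Local Notation wave := (wave m l).
Local Notation lat := (lat R m).
Local Notation bsq := (@bsq R n m).
Implicit Types (k w : 'rV[int]_n.+1) (x z y xi : 'rV[C]_n.+1) (p r : 'I_n.+1).

Definition rmul p r : nat := if (p == ord_max) || (r == ord_max) then 1 else m.

(** Half the squared length of the root [rt p r]. *)
Definition hlen p r : C := (bsq p + bsq r) / 2.

(** The contribution to the top coefficient of the Baker-Akhiezer function of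
    the root [rt p r], as a function of its pairing [D] with [x]. *)
Definition gfac p r (D : C) : C :=
  \prod_(1 <= j < (rmul p r).+1) qbr l (hlen p r * j%:R - D).

(** The two families of conditions in a uniform shape: in the coordinates
    [lcoord], both concern a pair [p < r] and a hyperplane
    [z_r = z_p + const]. *)
Definition root_invariant (F : 'rV[C]_n.+1 -> C) : Prop :=
  forall p r (j : nat) z, (p < r)%N -> (1 <= j <= rmul p r)%N ->
    lcoord m r z = lcoord m p z + (1 - bsq r) / 2 ->
    F (z + toC (j%:R *: lat_basis R m p)) = F (z + toC (j%:R *: lat_basis R m r)).

Lemma lt_neq_max p r : (p < r)%N -> p != ord_max.
Proof. by move=> pr; apply: contraTneq pr => ->; rewrite -leqNgt -ltnS ltn_ord. Qed.

Lemma lat_basis_lift (i : 'I_n) : lat_basis R m (lift ord_max i) = ev R (lift ord_max i).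
Proof. by rewrite /lat_basis eq_sym (negPf (neq_lift _ _)) scale1r. Qed.

Lemma lat_basis_max : lat_basis R m ord_max = sqm R m *: ev R (ord_max : 'I_n.+1).
Proof. by rewrite /lat_basis eqxx. Qed.

Lemma lcoord_lift (i : 'I_n) z : lcoord m (lift ord_max i) z = z ord0 (lift ord_max i).
Proof. by rewrite /lcoord /bnorm eq_sym (negPf (neq_lift _ _)) mul1r. Qed.

Lemma lcoord_max z : lcoord m ord_max z = (sqm R m)%:C * z ord0 ord_max.
Proof. by rewrite /lcoord /bnorm eqxx. Qed.

Lemma quasi_invariant_root F : quasi_invariant m l F -> root_invariant F.
Proof.
move=> [H1 H2] p r j z pr.
have := lt_neq_max pr; case: (unliftP ord_max p) pr => [i ->|->]; last by rewrite eqxx.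
case: (unliftP ord_max r) => [i' ->|->] pr _.
  rewrite /rmul ![lift _ _ == _]eq_sym !(negPf (neq_lift _ _)) /= => jm.
  rewrite /bsq eq_sym (negPf (neq_lift _ _)) subrr mul0r addr0 !lcoord_lift => zz.
  rewrite !lat_basis_lift; apply: H1 => //; last by rewrite zz.
  by move: pr; rewrite !lift_max.
rewrite /rmul eqxx orbT -eqn_leq => /eqP <-; rewrite !scale1r.
rewrite lat_basis_max lat_basis_lift /bsq eqxx lcoord_lift lcoord_max => zz.
by apply: H2; rewrite -mulrA zz; congr (qpow l _); field.
Qed.

(** The fibres of [collapse p r] are the strings in the direction [rt p r]. *)
Definition collapse p r k : 'rV[int]_n.+1 :=
  \row_i (if i == r then 0 else if i == p then k ord0 p + k ord0 r else k ord0 i).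

Lemma collapse_string p r k w : (p < r)%N -> collapse p r k = collapse p r w ->
  k = w + (w ord0 r - k ord0 r) *: rt p r.
Proof.
move=> pr /rowP H; apply/rowP => i; have := H i.
have [->|ip] := eqVneq i p.
  rewrite string_head // !mxE -val_eqE /= ltn_eqF // eqxx => E.
  by rewrite addrA -E addrK.
have [->|ir] := eqVneq i r; first by rewrite string_tail // subKr.
by rewrite string_other // !mxE (negPf ip) (negPf ir).
Qed.

Lemma string_collapse p r w t : (p < r)%N -> collapse p r (w + t *: rt p r) = collapse p r w.
Proof.
move=> pr; apply/rowP => i; rewrite [LHS]mxE [RHS]mxE string_head // string_tail //.
have [//|ir] := eqVneq i r; have [_|ip] := eqVneq i p; first by rewrite addrACA subrr addr0.
by rewrite string_other.
Qed.

Definition slope xi p r k : C :=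
  lcoord m p (xi + toC (lat k)) - lcoord m r (xi + toC (lat k)).

Lemma slopeE xi p r k : slope xi p r k =
  lcoord m p xi - lcoord m r xi + (bsq p * (k ord0 p)%:~R - bsq r * (k ord0 r)%:~R).
Proof. by rewrite /slope !lcoordD !lcoord_lat // ; ring. Qed.

Lemma slope_string xi p r w t : (p < r)%N ->
  slope xi p r (w + t *: rt p r) = slope xi p r w + 2 * hlen p r * t%:~R.
Proof.
move=> pr; rewrite !slopeE string_head // string_tail // intrD intrB /hlen.
by field.
Qed.

Lemma hlen_lt p r : (p < r)%N -> hlen p r = (1 + bsq r) / 2.
Proof. by move=> /lt_neq_max /negPf pm; rewrite /hlen {1}/bsq pm. Qed.

(** On the hyperplane of [root_invariant], waves whose exponents lie on the
    same string agree up to a constant, while those of different strings remain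
    independent.  So the invariance splits into one linear relation between
    coefficients for each string. *)
Lemma string_relation xi (s : seq 'rV[int]_n.+1) (c : 'rV[int]_n.+1 -> C) :
  root_invariant (fun z => \sum_(k <- s) c k * wave xi k z) ->
  forall p r (j : nat) w, (p < r)%N -> (1 <= j <= rmul p r)%N ->
  \sum_(k <- s | collapse p r k == collapse p r w) c k * qbr l (j%:R * slope xi p r k) = 0.
Proof.
move=> H p r j w pr jm.
have bp : bsq p = 1 by rewrite /bsq (negPf (lt_neq_max pr)).
have pr' : p != r by rewrite -val_eqE /= ltn_eqF.
pose Y i k : C := lcoord m i (xi + toC (lat k)).
pose d : C := (1 - bsq r) / 2.
pose g k : C := qpow l (2 * (k ord0 r)%:~R * d) *
  (qpow l (2 * j%:R * Y p k) - qpow l (2 * j%:R * Y r k)).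
have G : \sum_(k <- s | collapse p r k == collapse p r w) c k * g k = 0.
  apply: (characters_grouped (@monoD R n l) (@mono0 R n l) (mono_neq q_not_root)) => y.
  (* the point of the hyperplane with the same coordinates off [r] *)
  pose y' : 'rV[C]_n.+1 := \row_i (if i == r then y ord0 p + d else y ord0 i).
  have := H p r j (of_lcoord m y') pr jm.
  rewrite !of_lcoordK // !mxE eqxx (negPf pr') => /(_ erefl) E.
  apply: (mulfI (qpow_neq0 l (2 * dotp xi (of_lcoord m y')))).
  rewrite mulr0; move/eqP: E; rewrite -subr_eq0 -sumrB => /eqP E; rewrite -[RHS]E.
  rewrite mulr_sumr; apply: eq_bigr => k _; rewrite !wave_shift wave_of_lcoord //.
  rewrite -/(Y p k) -/(Y r k).
  have -> : mono l k y' = mono l (collapse p r k) y * qpow l (2 * (k ord0 r)%:~R * d).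
    rewrite /mono -qpowD; congr (qpow l _); rewrite -mulrA -mulrDr; congr (2 * _).
    rewrite (bigD1 r) // (bigD1 p) //= [in RHS](bigD1 r) //= [in RHS](bigD1 p) //=.
    rewrite !mxE !eqxx (negPf pr').
    rewrite (eq_bigr (fun i => (collapse p r k ord0 i)%:~R * y ord0 i)) => [|i]; last first.
      by case/andP=> /negPf ir /negPf ip; rewrite !mxE ir ip.
    by rewrite intrD; ring.
  by rewrite /g; ring.
have {}G : \sum_(k <- s | collapse p r k == collapse p r w)
    qpow l (j%:R * (Y p w + Y r w) + 2 * (w ord0 r)%:~R * d) *
    (c k * qbr l (j%:R * slope xi p r k)) = 0.
  rewrite -[RHS]G; apply: eq_bigr => k /eqP /(collapse_string pr) kw.
  rewrite mulrCA; congr (_ * _); rewrite /g /slope -/(Y p k) -/(Y r k) /qbr.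
  set t := w ord0 r - k ord0 r in kw.
  have kr : k ord0 r = w ord0 r - t by rewrite /t; ring.
  have Yp : Y p k = Y p w + t%:~R.
    by rewrite /Y !lcoordD !lcoord_lat // kw string_head // bp; rewrite intrD; ring.
  have Yr : Y r k = Y r w - bsq r * t%:~R.
    by rewrite /Y !lcoordD !lcoord_lat // kw string_tail //; rewrite intrB; ring.
  (* if [r] is the last coordinate, only [j = 1] occurs; otherwise [bsq r = 1] *)
  have jr : (1 - bsq r) * (1 - j%:R) = 0.
    move: jm; rewrite /rmul /bsq (negPf (lt_neq_max pr)) /=.
    case: (r == ord_max) => [|_]; last by rewrite subrr mul0r.
    by rewrite -eqn_leq => /eqP <-; rewrite subrr mulr0.
  have e0 : t%:~R * ((1 - bsq r) * (1 - j%:R)) = 0 :> C by rewrite jr mulr0.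
  rewrite kr Yp Yr !mulrBr -!qpowD intrB /d.
  by congr (qpow l _ - qpow l _); apply/eqP; rewrite -subr_eq0 -[X in _ == X]e0;
    apply/eqP; field.
move/eqP: G; rewrite -mulr_sumr mulf_eq0 (negPf (qpow_neq0 _ _)) => /eqP.
exact.
Qed.

End Strings.

Section Edges.
Variables (R : realType) (n m : nat) (l : R[i]).
Hypothesis m_gt0 : (0 < m)%N.
Hypothesis q_not_root : forall k, (0 < k)%N -> qpow l 1 ^+ k != 1.
Local Notation C := R[i].
Local Notation wave := (wave m l).
Local Notation rmul := (@rmul n m).
Local Notation hlen := (@hlen R n m).
Local Notation gfac := (@gfac R n m l).
Local Notation slope := (@slope R n m).
Implicit Types (k w : 'rV[int]_n.+1) (x z y xi : 'rV[C]_n.+1) (p r : 'I_n.+1).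

(** The quantum number of [j d] is that of [d] times a Chebyshev polynomial of
    degree [j - 1] in [q^d + q^-d].  So the relations for [j = 1, ..., M] give
    all those with an arbitrary polynomial of degree less than [M]. *)
Lemma quantum_chebyshev (I : Type) (s : seq I) (P : pred I) (c d : I -> C) (M : nat) :
  (forall j, (1 <= j <= M)%N -> \sum_(i <- s | P i) c i * qbr l (j%:R * d i) = 0) ->
  forall Q : {poly C}, (size Q <= M)%N ->
  \sum_(i <- s | P i) c i * (qbr l (d i) * Q.[qpow l (d i) + qpow l (- d i)]) = 0.
Proof.
move=> H Q sQ.
have mono_rel e j : (1 <= j)%N -> (j + e <= M)%N ->
    \sum_(i <- s | P i) c i * (qbr l (j%:R * d i) *
      (qpow l (d i) + qpow l (- d i)) ^+ e) = 0.
  elim: e j => [|e IH] j j1 jM.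
    by under eq_bigr do rewrite mulr1; apply: H; rewrite j1 -(addn0 j).
  have step i : c i * (qbr l (j%:R * d i) * (qpow l (d i) + qpow l (- d i)) ^+ e.+1) =
     c i * (qbr l (j.+1%:R * d i) * (qpow l (d i) + qpow l (- d i)) ^+ e) +
     c i * (qbr l (j.-1%:R * d i) * (qpow l (d i) + qpow l (- d i)) ^+ e).
    rewrite -mulrDr -mulrDl exprS; congr (_ * _); rewrite mulrA; congr (_ * _).
    pose a : C := j.-1%:R; have jE : j%:R = a + 1 by rewrite natr1 prednK.
    rewrite /qbr !mulrDr !mulrBl -!qpowD -natr1 !jE -/a.
    rewrite (_ : (a + 1) * d i + d i = (a + 1 + 1) * d i); last by ring.
    rewrite (_ : - ((a + 1) * d i) + d i = - (a * d i)); last by ring.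
    rewrite (_ : (a + 1) * d i - d i = a * d i); last by ring.
    rewrite (_ : - ((a + 1) * d i) - d i = - ((a + 1 + 1) * d i)); last by ring.
    by ring.
  under eq_bigr do rewrite step.
  rewrite big_split /= IH ?addSnnS // add0r; case: j j1 jM {step} => // -[|j] _ jM /=.
    by rewrite big1 // => i _; rewrite mul0r /qbr oppr0 subrr mul0r mulr0.
  by apply: IH => //; apply: leq_trans jM; exact: leq_add (leqnSn _) (leqnSn _).
under eq_bigr do rewrite horner_coef !mulr_sumr.
rewrite exchange_big big1 // => e _.
have /(congr1 (fun a => Q`_e * a)) : \sum_(i <- s | P i) c i * (qbr l (1%:R * d i) *
    (qpow l (d i) + qpow l (- d i)) ^+ e) = 0.
  by apply: mono_rel => //; apply: leq_trans sQ; rewrite add1n.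
rewrite mulr0 mulr_sumr => E; rewrite -[RHS]E; apply: eq_bigr => i _.
by rewrite mul1r; ring.
Qed.

Lemma qbr_prod_sign (a b : nat) (F : nat -> C) :
  \prod_(a <= j < b) qbr l (- F j) = (-1) ^+ (b - a) * \prod_(a <= j < b) qbr l (F j).
Proof.
under eq_bigr do rewrite qbrN -mulN1r.
by rewrite big_split /= prodr_const_nat.
Qed.

(** A string supported on [w, w - rt, ..., w - M rt], where [M] is the
    multiplicity, carries a function satisfying [M] relations, so it is
    determined up to a factor.  Testing against the polynomial that vanishes
    at the interior points compares its two end values. *)
Lemma edge_relation xi (s : seq 'rV[int]_n.+1) (c : 'rV[int]_n.+1 -> C) p r w :
  uniq s -> (forall k, c k != 0 -> k \in s) -> (p < r)%N ->
  root_invariant m (fun z => \sum_(k <- s) c k * wave xi k z) ->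
  (forall t : int, c (w + t *: rt p r) != 0 -> - (rmul p r)%:Z <= t <= 0) ->
  let D := slope xi p r w - hlen p r * (rmul p r)%:R in
  c w * gfac p r (- D) = c (w + (- (rmul p r)%:Z) *: rt p r) * gfac p r D.
Proof.
move=> us cs pr inv seg D.
have Hrel j := string_relation m_gt0 q_not_root inv (j := j) w pr.
set M := rmul p r in seg D Hrel *.
have M0 : (0 < M)%N by rewrite /M /rmul; case: ifP.
set h := hlen p r in D *; set d := slope xi p r w in D *.
pose u (t : nat) := w + (- t%:Z) *: rt p r.
have u_inj : injective u.
  move=> t t' /rowP /(_ p); rewrite !string_head // => /addrI /oppr_inj [].
  exact.
have du t : slope xi p r (u t) = d - 2 * h * t%:R.
  by rewrite slope_string // mulrNz mulrN.
pose v (t : nat) := qpow l (d - 2 * h * t%:R) + qpow l (- (d - 2 * h * t%:R)).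
(* the polynomial vanishing at all interior points of the string *)
pose Q := \prod_(a <- map v (index_iota 1 M)) ('X - a%:P).
have sQ : (size Q <= M)%N by rewrite size_prod_XsubC size_map size_iota subn1 prednK.
have Qroot t : (1 <= t < M)%N -> Q.[v t] = 0.
  move=> tM; apply/eqP; rewrite -rootE root_prod_XsubC.
  by rewrite map_f // mem_index_iota.
have Hu t : collapse p r (u t) = collapse p r w by exact: string_collapse.
have sumQ : \sum_(t <- iota 0 M.+1) c (u t) * (qbr l (d - 2 * h * t%:R) * Q.[v t]) = 0.
  pose Fk k := if collapse p r k == collapse p r w then
    c k * (qbr l (slope xi p r k) *
      Q.[qpow l (slope xi p r k) + qpow l (- slope xi p r k)]) else 0.
  have : \sum_(k <- s) Fk k = 0.
    rewrite -big_mkcond.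
    exact: (quantum_chebyshev (M := M) Hrel).
  rewrite (@sum_same_support _ _ s [seq u t | t <- iota 0 M.+1]) //; first last.
  - move=> k; rewrite /Fk; case: (eqVneq (collapse p r k) _) => [kw|_]; last by rewrite eqxx.
    have [->|ck _] := eqVneq (c k) 0; first by rewrite mul0r eqxx.
    rewrite (cs _ ck); symmetry; apply/mapP.
    have kE := collapse_string pr kw; set t := _ - _ in kE.
    have /andP[tM t0] : - M%:Z <= t <= 0 by apply: seg; rewrite -kE.
    exists (absz t); first by rewrite mem_iota; lia.
    by rewrite /u kE; congr (_ + _ *: _); lia.
  - by rewrite map_inj_uniq // iota_uniq.
  rewrite big_map => E; rewrite -[RHS]E; apply: eq_bigr => t _.
  by rewrite /Fk Hu eqxx du.
have two : c (u 0%N) * (qbr l d * Q.[v 0%N]) +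
           c (u M) * (qbr l (d - 2 * h * M%:R) * Q.[v M]) = 0.
  move: sumQ; rewrite -[M.+1]addn1 iotaD big_cat /= big_seq1 add0n.
  rewrite -{1}(prednK M0) /= big_cons big_seq big1 ?addr0 ?mulr0 ?subr0 // => t.
  by rewrite mem_iota => tM; rewrite Qroot ?mulr0 //; lia.
have Qv a : Q.[v a] = \prod_(1 <= t < M) qbr l (h * (t%:R - a%:R)) *
    \prod_(1 <= t < M) qbr l (d - h * (a%:R + t%:R)).
  rewrite horner_prod big_map -big_split; apply: eq_bigr => t _.
  rewrite hornerXsubC qpow_sumB.
  by congr (qbr l _ * qbr l _); field.
have dE : d = D + h * M%:R by rewrite /D subrK.
have top : qbr l d * \prod_(1 <= t < M) qbr l (d - h * (0%:R + t%:R)) = gfac p r (- D).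
  rewrite /gfac -/M -/h [RHS]big_add1 /= [RHS]big_nat_rev /= [RHS]big_ltn //.
  rewrite add0n subnSK // subn0; congr (_ * _); first by rewrite dE; congr (qbr l _); ring.
  apply: eq_big_nat => t /andP[_ tM]; rewrite subnSK // natrB ?(ltnW tM) // dE.
  by congr (qbr l _); ring.
have bottom : qbr l (d - 2 * h * M%:R) *
    \prod_(1 <= t < M) qbr l (d - h * (M%:R + t%:R)) = (-1) ^+ M * gfac p r D.
  rewrite /gfac -/M -/h mulrC -[X in (-1) ^+ X](subn1 M.+1) -qbr_prod_sign.
  rewrite big_nat_recr //=; congr (_ * _); last by rewrite dE; congr (qbr l _); ring.
  by apply: eq_big_nat => t _; rewrite dE; congr (qbr l _); ring.
pose B := \prod_(1 <= t < M) qbr l (h * t%:R).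
have B0 : B != 0.
  rewrite prodf_seq_neq0; apply/allP => t; rewrite mem_index_iota => /andP[t0 tM] /=.
  suff -> : h = 1 by rewrite mul1r qbr_nat_neq0.
  move: (leq_ltn_trans t0 tM); rewrite /h hlen_lt // /M /rmul /bsq.
  by case: ifP => // /norP[_ /negPf ->] _; field.
have PM : \prod_(1 <= t < M) qbr l (h * (t%:R - M%:R)) = (-1) ^+ M.-1 * B.
  rewrite -subn1 -qbr_prod_sign big_nat_rev; apply: eq_big_nat => t /andP[_ tM].
  rewrite add1n subSS natrB ?(ltnW tM) //; congr (qbr l _); ring.
have P0 : \prod_(1 <= t < M) qbr l (h * (t%:R - 0%:R)) = B.
  by apply: eq_bigr => t _; rewrite subr0.
have u0 : u 0%N = w by rewrite /u oppr0 scale0r addr0.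
move: two; rewrite u0 !Qv P0 PM [X in c w * X]mulrCA top.
rewrite [X in c (u M) * X]mulrCA bottom => two.
apply: (mulfI B0); apply/eqP; rewrite -subr_eq0 -[X in _ == X]two; apply/eqP.
have : (-1) ^+ M.-1 * (-1) ^+ M = -1 :> C.
  by rewrite -exprD -[in X in (_ + X)%N](prednK M0) addnS exprS -signr_odd oddD addbb mulr1.
move=> sgn; rewrite (_ : (-1) ^+ M.-1 * B * _ = ((-1) ^+ M.-1 * (-1) ^+ M) * B * gfac p r D).
  by rewrite sgn; ring.
by ring.
Qed.

End Edges.

Section Room.
Variables (R : realType) (n m : nat) (l : R[i]).
Hypothesis m_gt0 : (0 < m)%N.
Hypothesis q_not_root : forall k, (0 < k)%N -> qpow l 1 ^+ k != 1.
Local Notation C := R[i].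
Local Notation wave := (wave m l).
Local Notation rmul := (@rmul n m).
Local Notation hlen := (@hlen R n m).
Local Notation gfac := (@gfac R n m l).
Local Notation slope := (@slope R n m).
Implicit Types (k w : 'rV[int]_n.+1) (x z y xi : 'rV[C]_n.+1) (p r : 'I_n.+1).

(** The weights at [w] of the edge relations are non-zero: such a relation
    then forces the coefficient at [w] to vanish if the one at the other end
    of the edge does. *)
Definition edge_generic xi w : Prop := forall p r, (p < r)%N ->
  gfac p r (- (slope xi p r w - hlen p r * (rmul p r)%:R)) != 0.

(** Combines [string_room] with the edge relation, by which a string that
    stopped short of the multiplicity would have a zero coefficient at its
    first point. *)
Lemma room_below_first xi (s : seq 'rV[int]_n.+1) (c : 'rV[int]_n.+1 -> C) mu :
  uniq s -> (forall k, c k != 0 -> k \in s) ->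
  root_invariant m (fun z => \sum_(k <- s) c k * wave xi k z) ->
  (forall w, w \in s -> edge_generic xi w) ->
  c mu != 0 -> (forall v, v \in s -> ~~ colex v mu) ->
  forall i, exists2 v, v \in s & v ord0 i <= mu ord0 i - (up rmul i)%:Z.
Proof.
move=> us cs inv gen cmu first i.
have [w p r cw pr down|//|v /cs /first //|v /cs vs vi] :=
  @string_room n rmul (fun v => c v != 0) mu i; last by exists v.
have [//|none] := pselect (exists2 t : int, t <= - (rmul p r)%:Z & c (w + t *: rt p r) != 0).
have seg (t : int) : c (w + t *: rt p r) != 0 -> - (rmul p r)%:Z <= t <= 0.
  move=> ct; rewrite down // andbT leNgt; apply/negP => tM; apply: none.
  by exists t => //; exact: ltW.
have := edge_relation m_gt0 q_not_root us cs pr inv seg.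
have -> : c (w + (- (rmul p r)%:Z) *: rt p r) = 0.
  by apply/eqP/negPn/negP => ct; apply: none; exists (- (rmul p r)%:Z).
rewrite /= mul0r => /eqP; rewrite mulf_eq0 (negPf cw) /=.
by rewrite (negPf (gen w (cs _ cw) p r pr)).
Qed.

End Room.

(** * The polytope and the half-sum of the roots *)

Section Polytope.
Variables (R : realType) (n m : nat).
Hypothesis m_gt0 : (0 < m)%N.
Local Notation rmul := (@rmul n m).
Local Notation lat := (lat R m).
Implicit Types (k w : 'rV[int]_n.+1) (p r : 'I_n.+1).

Definition root_pair (a : posroot n) : 'I_n.+1 * 'I_n.+1 :=
  match a with
  | inl p => (lift ord_max (val p).1, lift ord_max (val p).2)
  | inr i => (lift ord_max i, ord_max)
  end.

Lemma root_pair_lt a : ((root_pair a).1 < (root_pair a).2)%N.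
Proof.
case: a => [[p pr]|i].
  by have : (lift ord_max p.1 < lift ord_max p.2)%N by rewrite !lift_max.
by have : (lift ord_max i < @ord_max n)%N by rewrite lift_max; exact: ltn_ord.
Qed.

Lemma root_mult_pair a : root_mult m a = rmul (root_pair a).1 (root_pair a).2.
Proof.
case: a => [p|i] /=; rewrite /rmul ?eqxx ?orbT //.
by rewrite ![lift _ _ == _]eq_sym !(negPf (neq_lift _ _)).
Qed.

Lemma latB k w : lat (k - w) = lat k - lat w.
Proof. by apply/rowP => p; rewrite !(mxE, lat_entry) intrB mulrBl. Qed.

Lemma lat_rt p r : lat (rt p r) = lat_basis R m p - lat_basis R m r.
Proof. by rewrite latB !lat_delta. Qed.

Lemma root_vec_pair a : root_vec R m a = lat (rt (root_pair a).1 (root_pair a).2).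
Proof.
by case: a => [p|i] /=; rewrite lat_rt !lat_basis_lift ?lat_basis_max.
Qed.

Lemma root_pair_inj : injective root_pair.
Proof.
move=> a b e; have := congr1 fst e; have := congr1 snd e.
case: a b {e} => [p|i] [p'|i']; rewrite /root_pair /fst /snd.
- move=> /lift_inj e2 /lift_inj e1; congr inl; apply: val_inj.
  by case: (val p) (val p') e1 e2 => [a b] [a' b'] /= -> ->.
- by move=> e; case/eqP: (neq_lift ord_max (val p).2).
- by move=> e; case/eqP: (neq_lift ord_max (val p').2).
- by move=> _ /lift_inj ->.
Qed.

Lemma root_pair_onto p r : (p < r)%N -> exists a, root_pair a = (p, r).
Proof.
move=> pr; have := lt_neq_max pr.
case: (unliftP ord_max p) pr => [i ->|->]; last by rewrite eqxx.
case: (unliftP ord_max r) => [i' ->|->] pr _; last by exists (inr i).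
have ii' : (i < i')%N by move: pr; rewrite !lift_max.
by exists (inl (exist (fun u : 'I_n * 'I_n => (u.1 < u.2)%N) (i, i') ii')).
Qed.

Lemma big_posroot (T : Type) (idx : T) (op : Monoid.com_law idx)
    (F : 'I_n.+1 -> 'I_n.+1 -> T) :
  \big[op/idx]_(a : posroot n) F (root_pair a).1 (root_pair a).2 =
  \big[op/idx]_(u : 'I_n.+1 * 'I_n.+1 | (u.1 < u.2)%N) F u.1 u.2.
Proof.
rewrite -(big_map root_pair xpredT (fun u => F u.1 u.2)) -[RHS]big_filter.
apply: perm_big; apply: uniq_perm.
- by rewrite map_inj_uniq ?index_enum_uniq //; exact: root_pair_inj.
- by rewrite filter_uniq // index_enum_uniq.
move=> [p r]; rewrite mem_filter mem_index_enum andbT /=; apply/mapP/idP.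
  by move=> [a _ e]; have := root_pair_lt a; rewrite -e.
by move=> /root_pair_onto[a <-]; exists a; rewrite ?mem_index_enum.
Qed.

Lemma sum_rt (A : 'I_n.+1 -> bool) p r :
  \sum_(i | A i) rt p r ord0 i = (A p)%:Z - (A r)%:Z.
Proof.
have E j : \sum_(i | A i) (i == j)%:Z = (A j)%:Z.
  rewrite big_mkcond (bigD1 j) //= eqxx big1 => [|i /negPf ->].
    by rewrite addr0; case: (A j).
  by case: (A i).
by under eq_bigr do rewrite rtE; rewrite sumrB !E.
Qed.

(** Points of the polytope are obtained from its top vertex by subtracting
    positive roots, each with a coefficient between 0 and its multiplicity. *)
Lemma polytope_in_support k :
  polytopeN m (rho R n m + lat k) -> in_support rmul k.
Proof.
move=> [c [cP E]].
have kE p : (k ord0 p)%:~R = \sum_(a : posroot n) (c a - (root_mult m a)%:R) *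
    (rt (root_pair a).1 (root_pair a).2 ord0 p)%:~R.
  have : lat k = \sum_(a : posroot n) (c a - (root_mult m a)%:R) *: root_vec R m a.
    apply: (addrI (rho R n m)); rewrite E; under [X in _ = _ + X]eq_bigr do rewrite scalerBl.
    rewrite sumrB /rho; set S := \sum_(a : posroot n) (root_mult m a)%:R *: _.
    by rewrite addrCA addrC; congr (_ + _); apply/rowP => i; rewrite !mxE; field.
  move=> /rowP H; have := H p; rewrite lat_entry summxE => Ep.
  apply: (mulIf (bnorm_neq0 R m_gt0 p)); rewrite Ep mulr_suml; apply: eq_bigr => a _.
  by rewrite mxE root_vec_pair lat_entry mulrA.
have sumE (A : 'I_n.+1 -> bool) : (\sum_(p | A p) k ord0 p)%:~R =
    \sum_(a : posroot n) (c a - (root_mult m a)%:R) *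
      ((A (root_pair a).1)%:Z - (A (root_pair a).2)%:Z)%:~R.
  transitivity (\sum_(p | A p) (k ord0 p)%:~R : R); first exact: rmorph_sum.
  under eq_bigr do rewrite kE.
  rewrite exchange_big; apply: eq_bigr => a _.
  by rewrite -mulr_sumr -sum_rt; congr (_ * _); apply: esym; exact: rmorph_sum.
split.
  apply: (@intr_inj R); rewrite /vsum (sumE xpredT) big1 // => a _.
  by rewrite subrr mulr0.
move=> A; rewrite -(ler_int R) sumE.
have -> : (\sum_(p | ~~ A p) \sum_(r | A r && (p < r)%N) rmul p r =
    \sum_(a : posroot n) if ~~ A (root_pair a).1 && A (root_pair a).2
      then root_mult m a else 0)%N.
  rewrite pair_big_dep /=; transitivity
    (\sum_(u : 'I_n.+1 * 'I_n.+1 | (u.1 < u.2)%N)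
       if ~~ A u.1 && A u.2 then rmul u.1 u.2 else 0)%N.
    rewrite -big_mkcondr; apply: eq_bigl => u /=.
    by case: (A u.1); case: (A u.2); rewrite /= ?andbT ?andbF.
  rewrite -(big_posroot _ (fun p r => if ~~ A p && A r then rmul p r else 0%N)).
  by apply: eq_bigr => a _; rewrite root_mult_pair.
rewrite -pmulrn natr_sum; apply: ler_sum => a _; have /andP[c0 cm] := cP a.
have m0 : 0 <= (root_mult m a)%:R :> R by exact: ler0n.
case: (A _); case: (A _) => /=; rewrite ?subrr ?subr0 ?sub0r ?mulr0 ?mulr1 ?subr_le0 //.
by rewrite mulrN1 opprB lerBlDr lerDl.
Qed.

End Polytope.

Section WeylVector.
Variables (R : realType) (n m : nat).
Hypothesis m_gt0 : (0 < m)%N.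
Local Notation C := R[i].
Local Notation rmul := (@rmul n m).
Local Notation lat := (lat R m).
Local Notation bsq := (@bsq R n m).
Implicit Types (k w : 'rV[int]_n.+1) (p r : 'I_n.+1).

Lemma rho_lat : rho R n m = 2^-1 *: lat (\row_p ((up rmul p)%:Z - (down rmul p)%:Z)).
Proof.
congr (_ *: _); apply/rowP => p; rewrite lat_entry summxE mxE.
transitivity (\sum_(a : posroot n) ((rmul (root_pair a).1 (root_pair a).2)%:Z *
    rt (root_pair a).1 (root_pair a).2 ord0 p)%:~R * bnorm R m p).
  by apply: eq_bigr => a _; rewrite mxE root_vec_pair lat_entry root_mult_pair intrM mulrA.
rewrite -mulr_suml; congr (_ * _).
transitivity ((\sum_(a : posroot n) (rmul (root_pair a).1 (root_pair a).2)%:Z *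
    rt (root_pair a).1 (root_pair a).2 ord0 p)%:~R : R); first by apply: esym; exact: rmorph_sum.
congr (_%:~R); rewrite (big_posroot _ (fun p' r : 'I_n.+1 => (rmul p' r)%:Z * rt p' r ord0 p)).
under eq_bigr do rewrite rtE mulrBr; rewrite sumrB; congr (_ - _).
  rewrite -(pair_big_dep xpredT (fun i j : 'I_n.+1 => (i < j)%N)
    (fun i j : 'I_n.+1 => (rmul i j)%:Z * (p == i)%:Z)) /= (bigD1 p) //= [X in _ + X]big1 => [|i /negPf ip].
    by rewrite addr0 /up Posz_sum; apply: eq_bigr => r _; rewrite eqxx mulr1.
  by rewrite big1 // => j _; rewrite eq_sym ip mulr0.
rewrite -(pair_big_dep xpredT (fun i j : 'I_n.+1 => (i < j)%N)
    (fun i j : 'I_n.+1 => (rmul i j)%:Z * (p == j)%:Z)) /= /down Posz_sum [RHS]big_mkcond.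
apply: eq_bigr => i _; rewrite big_mkcond (bigD1 p) //= big1 ?addr0 => [|j /negPf jp].
  by case: ifP => //; rewrite eqxx mulr1.
by rewrite eq_sym jp mulr0 if_same.
Qed.

Lemma lcoord_rho p : lcoord m p (toC (rho R n m)) =
  bsq p * ((up rmul p)%:R - (down rmul p)%:R) / 2.
Proof.
rewrite rho_lat toCZ /lcoord mxE mulrCA -/(lcoord m p _) lcoord_lat // mxE.
by rewrite intrB -!pmulrn rmorphV ?unitfE ?pnatr_eq0 // rmorph_nat mulrC.
Qed.

Lemma sum_range_const (N a b c : nat) : (b <= N)%N ->
  (\sum_(r < N | (a <= r < b)%N) c = (b - a) * c)%N.
Proof.
move=> bN; rewrite -(big_mkord (fun t : nat => a <= t < b)%N (fun=> c)) -sum_nat_const_nat.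
by rewrite [RHS](big_nat_widenl _ 0) // [RHS](big_nat_widen _ _ N).
Qed.

Lemma rmul_lift (i j : 'I_n) : rmul (lift ord_max i) (lift ord_max j) = m.
Proof. by rewrite /rmul ![lift _ _ == _]eq_sym !(negPf (neq_lift _ _)). Qed.

Lemma rmul_max p : rmul p ord_max = 1%N.
Proof. by rewrite /rmul eqxx orbT. Qed.

Lemma bsq_lift (i : 'I_n) : bsq (lift ord_max i) = 1.
Proof. by rewrite /bsq eq_sym (negPf (neq_lift _ _)). Qed.

Lemma bsq_max : bsq ord_max = m%:R.
Proof. by rewrite /bsq eqxx. Qed.

Lemma widen_lift (i : 'I_n) : widen_ord (leqnSn n) i = lift ord_max i.
Proof. by apply: val_inj; exact/esym/lift_max. Qed.

Lemma up_lift (i : 'I_n) : up rmul (lift ord_max i) = ((n - i.+1) * m + 1)%N.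
Proof.
rewrite /up big_mkcond big_ord_recr /= rmul_max /bump leqNgt ltn_ord /= ltn_ord.
congr addn; rewrite -(@sum_range_const n) // [RHS]big_mkcond; apply: eq_bigr => r _.
by rewrite widen_lift rmul_lift ltn_ord andbT.
Qed.

Lemma down_lift (i : 'I_n) : down rmul (lift ord_max i) = (i * m)%N.
Proof.
rewrite /down big_mkcond big_ord_recr /= /bump leqNgt ltn_ord /= ltnNge (ltnW (ltn_ord i)) addn0.
rewrite -[in RHS](subn0 i) -(@sum_range_const n) ?(ltnW (ltn_ord i)) // [RHS]big_mkcond.
by apply: eq_bigr => r _; rewrite widen_lift rmul_lift.
Qed.

Lemma up_max : up rmul ord_max = 0%N.
Proof. by rewrite /up big1 // => p; rewrite ltnNge -ltnS ltn_ord. Qed.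

Lemma down_max : down rmul ord_max = n.
Proof.
rewrite /down -[RHS]muln1 -[in RHS](subn0 n) -(@sum_range_const n.+1) //.
by apply: eq_bigr => p _; rewrite rmul_max.
Qed.

(** The half-sum of the roots is such that along the path [edge_vertex] the
    edge weights depend on [x] alone: the analogue of the fact that a simple
    root [alpha] has [(rho, alpha) = m_alpha (alpha, alpha) / 2]. *)
Lemma edge_slope (x : 'rV[C]_n.+1) (i J : 'I_n.+1) : (J < i)%N ->
  slope m (x + toC (rho R n m)) J i (edge_vertex rmul i J.+1) -
    hlen R m J i * (rmul J i)%:R = lcoord m J x - lcoord m i x.
Proof.
move=> Ji; rewrite slopeE // !lcoordD !lcoord_rho.
have -> : edge_vertex rmul i J.+1 ord0 J = 0.
  by rewrite mxE -val_eqE /= ltn_eqF // ltnn.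
have -> : edge_vertex rmul i J.+1 ord0 i = (\sum_(r < n.+1 | (J < r < i)%N) rmul r i)%N%:Z.
  by rewrite mxE eqxx.
have := lt_neq_max Ji; case: (unliftP ord_max J) Ji => [j ->|->]; last by rewrite eqxx.
case: (unliftP ord_max i) => [i' ->|->] Ji _.
  have ji : (j < i')%N by move: Ji; rewrite !lift_max.
  rewrite hlen_lt // !bsq_lift rmul_lift !up_lift !down_lift.
  have -> : (\sum_(r < n.+1 | (lift ord_max j < r < lift ord_max i')%N) rmul r (lift ord_max i')
     = (i' - j.+1) * m)%N.
    rewrite !lift_max big_mkcond big_ord_recr /=.
    rewrite [(n < i')%N]ltnNge (ltnW (ltn_ord i')) andbF addn0.
    rewrite -(@sum_range_const n) ?(ltnW (ltn_ord i')) // [RHS]big_mkcond.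
    by apply: eq_bigr => r _; rewrite widen_lift rmul_lift.
  rewrite -!pmulrn !natrM !natrD !natrM !natrB //.
  by rewrite -!natr1; field.
rewrite hlen_lt // bsq_lift !bsq_max rmul_max up_lift down_lift up_max down_max.
have -> : (\sum_(r < n.+1 | (lift ord_max j < r < @ord_max n)%N) rmul r ord_max = n - j.+1)%N.
  rewrite -[RHS]muln1 -(@sum_range_const n.+1) // lift_max.
  by apply: eq_bigr => r _; rewrite rmul_max.
rewrite -!pmulrn !natrD !natrM !natrB //.
by rewrite -!natr1; field.
Qed.

End WeylVector.

(** * The Baker-Akhiezer function in integer coordinates *)

Section BakerAkhiezer.
Variables (R : realType) (n m : nat) (l : R[i]).
Hypothesis m_gt0 : (0 < m)%N.
Hypothesis q_not_root : forall k, (0 < k)%N -> qpow l 1 ^+ k != 1.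
Local Notation C := R[i].
Local Notation wave := (wave m l).
Local Notation rmul := (@rmul n m).
Local Notation gfac := (@gfac R n m l).
Local Notation lat := (lat R m).
Local Notation rhoC := (toC (rho R n m)).
Implicit Types (k w : 'rV[int]_n.+1) (x z : 'rV[C]_n.+1) (p r : 'I_n.+1).

Definition top_coef x : C := \prod_(u : 'I_n.+1 * 'I_n.+1 | (u.1 < u.2)%N)
  gfac u.1 u.2 (lcoord m u.1 x - lcoord m u.2 x).

Lemma dotp_root p r z : dotp (toC (lat (rt p r))) z = lcoord m p z - lcoord m r z.
Proof.
have E j : \sum_i (i == j)%:Z%:~R * lcoord m i z = lcoord m j z.
  rewrite (bigD1 j) //= eqxx mul1r big1 ?addr0 // => i /negPf ->.
  by rewrite mul0r.
rewrite dotp_lat; under eq_bigr do rewrite rtE intrB mulrBl.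
by rewrite sumrB !E.
Qed.

Lemma root_factor p r (j : nat) x : (p < r)%N ->
  dotp (toC (lat (rt p r))) ((j%:R / 2) *: toC (lat (rt p r)) - x) =
  hlen R m p r * j%:R - (lcoord m p x - lcoord m r x).
Proof.
move=> pr; rewrite -scaleN1r dotpDr !dotpZr !dotp_root !lcoord_lat // !rtE !eqxx.
have /negPf pr' : p != r by rewrite -val_eqE /= ltn_eqF.
by rewrite pr' eq_sym pr' /hlen /=; field.
Qed.

Lemma in_support_enum : exists2 s : seq 'rV[int]_n.+1, uniq s &
  forall k, (k \in s) = `[< in_support rmul k >].
Proof.
apply: (@bounded_enum _ (fun k => `[< in_support rmul k >])
  (\sum_p (up rmul p + down rmul p))%N) => k p /asboolP Nk.
apply: le_trans (in_support_bounded p Nk) _; rewrite lez_nat.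
by rewrite (bigD1 p) //= leq_addr.
Qed.

Lemma in_support0 : in_support rmul 0.
Proof.
have z0 (A : 'I_n.+1 -> bool) : \sum_(p | A p) (0 : 'rV[int]_n.+1) ord0 p = 0.
  by rewrite big1 // => p _; rewrite mxE.
by split; [exact: z0 | move=> A; rewrite z0].
Qed.

Lemma rho_in_ba_support : ba_support m (rho R n m).
Proof.
split; first by apply/latP_lat; exists 0; rewrite subrr lat0.
exists (fun a => (root_mult m a)%:R); split=> [a|]; first by rewrite ler0n lexx.
apply: (addrI (rho R n m)); rewrite addrA subrr add0r /rho.
by apply/rowP => i; rewrite !mxE; field.
Qed.

(** The exponents of the function are written as the half-sum of the roots
    plus a lattice vector; coefficients outside the support are set to 0, so
    that sums can be taken over any large enough list. *)
Lemma BA_expansion Psi : normalized_BA m l Psi ->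
  exists psi : 'rV[int]_n.+1 -> 'rV[C]_n.+1 -> C,
  [/\ forall k, meromorphic (psi k),
      forall k x, psi k x != 0 -> in_support rmul k,
      generically (fun x => forall (s : seq 'rV[int]_n.+1), uniq s ->
        (forall k, in_support rmul k -> k \in s) ->
        forall z, Psi x z = \sum_(k <- s) psi k x * wave (x + rhoC) k z),
      generically (fun x => root_invariant m (Psi x)) &
      generically (fun x => psi 0 x = top_coef x)].
Proof.
move=> [psi0 [mer exp inv top]].
pose B k := `[< ba_support m (rho R n m + lat k) >].
exists (fun k x => if B k then psi0 (rho R n m + lat k) x else 0).
have Bsupp k : B k -> in_support rmul k.
  by move=> /asboolP[_]; exact: polytope_in_support.
split.
- by move=> k; case: (B k); [exact: mer | exact: meromorphic_cst].
- by move=> k x; case: ifP => [/Bsupp //|_]; rewrite eqxx.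
- apply: (generically_imply exp) => x E s us ss z; rewrite E.
  pose t := [seq rho R n m + lat k | k <- s & B k].
  have ut : uniq t.
    by rewrite map_inj_uniq ?filter_uniq // => k w /addrI /lat_inj; exact.
  have -> : ba_support (R := R) (n := n) m = [set` t].
    apply/seteqP; split=> [v [/latP_lat[k vk] vP]|v /mapP[k]].
      have vE : v = rho R n m + lat k by rewrite -vk addrC subrK.
      have Bk : B k by apply/asboolP; rewrite -vE; split=> //; apply/latP_lat; exists k.
      apply/mapP; exists k => //; rewrite mem_filter Bk /=.
      by apply: ss; exact: Bsupp.
    by rewrite mem_filter => /andP[/asboolP Bk _] ->.
  rewrite -fsbig_seq // big_map big_filter mulr_sumr big_mkcond; apply: eq_bigr => k _.
  case: ifP => _; last by rewrite mul0r.
  by rewrite mulrCA /wave toCD -qpowD -mulrDr -dotpDl addrA.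
- by apply: (generically_imply inv) => x; exact: quasi_invariant_root.
- apply: (generically_imply top) => x E.
  have -> : B 0 by apply/asboolP; rewrite lat0 addr0; exact: rho_in_ba_support.
  rewrite lat0 addr0 E /top_coef.
  rewrite -(big_posroot _ (fun p r => gfac p r (lcoord m p x - lcoord m r x))).
  apply: eq_bigr => a _; rewrite root_mult_pair; apply: eq_bigr => j _.
  by rewrite root_vec_pair /= root_factor // root_pair_lt.
Qed.

Lemma holomorphic_gfac p r (f : 'rV[C]_n.+1 -> C) x :
  holomorphic_at f x -> holomorphic_at (fun y => gfac p r (f y)) x.
Proof.
move=> hf; apply: holomorphic_prod => j _; apply: holomorphic_qbr.
by apply: holomorphicB => //; exact: holomorphic_cst.
Qed.

Lemma holomorphic_top_coef x : holomorphic_at top_coef x.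
Proof.
apply: holomorphic_prod => u _; apply: holomorphic_gfac.
by apply: holomorphicB; exact: holomorphic_lcoord.
Qed.

Lemma generically_gfac p r p' r' c : p != r ->
  generically (fun x => gfac p' r' (lcoord m p x - lcoord m r x + c) != 0).
Proof.
move=> pr.
have H j : j \in index_iota 1 (rmul p' r').+1 -> generically (fun x =>
    qbr l (hlen R m p' r' * j%:R - (lcoord m p x - lcoord m r x + c)) != 0).
  move=> _; rewrite eq_sym in pr.
  have := generically_qbr m_gt0 q_not_root (hlen R m p' r' * j%:R - c) pr.
  by move/generically_imply; apply=> x; apply: contra_neq => <-; congr (qbr l _); ring.
apply: (generically_imply (generically_all_in H)) => x Hx.
by rewrite /gfac prodf_seq_neq0; apply/allP => j /Hx.
Qed.

Lemma generically_top_coef : generically (fun x => top_coef x != 0).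
Proof.
have H (u : 'I_n.+1 * 'I_n.+1) : generically (fun x => (u.1 < u.2)%N ->
    gfac u.1 u.2 (lcoord m u.1 x - lcoord m u.2 x) != 0).
  have [u12|_] := boolP (u.1 < u.2)%N; last exact: generically_all_points.
  have u12' : u.1 != u.2 by rewrite -val_eqE /= ltn_eqF.
  apply: (generically_imply (generically_gfac u.1 u.2 0 u12')) => x.
  by rewrite addr0.
apply: (generically_imply (generically_finType H)) => x Hx.
by rewrite /top_coef; apply/prodf_neq0 => u; exact: Hx.
Qed.

Lemma generically_edge_generic w :
  generically (fun x => edge_generic m l (x + rhoC) w).
Proof.
have H (u : 'I_n.+1 * 'I_n.+1) : generically (fun x => (u.1 < u.2)%N ->
    gfac u.1 u.2 (- (slope m (x + rhoC) u.1 u.2 w - hlen R m u.1 u.2 * (rmul u.1 u.2)%:R)) != 0).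
  have [u12|_] := boolP (u.1 < u.2)%N; last exact: generically_all_points.
  have u21 : u.2 != u.1 by rewrite -val_eqE /= gtn_eqF.
  apply: (generically_imply (generically_gfac u.1 u.2
    (- (slope m rhoC u.1 u.2 w - hlen R m u.1 u.2 * (rmul u.1 u.2)%:R)) u21)) => x Hx _.
  by apply: contra_neq Hx => <-; congr gfac; rewrite !slopeE // !lcoordD; ring.
apply: (generically_imply (generically_finType H)) => x Hx p r pr.
exact: (Hx (p, r)).
Qed.

End BakerAkhiezer.

(** * Elimination: operators from functions *)

Section Elimination.
Variables (R : realType) (n m : nat) (l : R[i]).
Hypothesis m_gt0 : (0 < m)%N.
Hypothesis q_not_root : forall k, (0 < k)%N -> qpow l 1 ^+ k != 1.
Local Notation C := R[i].
Local Notation wave := (wave m l).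
Local Notation rmul := (@rmul n m).
Local Notation lat := (lat R m).
Local Notation latC k := (toC (lat k)).
Local Notation rhoC := (toC (rho R n m)).
Local Notation top_coef := (@top_coef R n m l).
Implicit Types (k v w kap : 'rV[int]_n.+1) (x z : 'rV[C]_n.+1) (p r : 'I_n.+1).

Variables (Psi : 'rV[C]_n.+1 -> 'rV[C]_n.+1 -> C).
Variable psi : 'rV[int]_n.+1 -> 'rV[C]_n.+1 -> C.
Hypothesis psi_meromorphic : forall k, meromorphic (psi k).
Hypothesis psi_support : forall k x, psi k x != 0 -> in_support rmul k.
Hypothesis Psi_expansion : generically (fun x =>
  forall (s : seq 'rV[int]_n.+1), uniq s -> (forall k, in_support rmul k -> k \in s) ->
  forall z, Psi x z = \sum_(k <- s) psi k x * wave (x + rhoC) k z).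
Hypothesis Psi_invariant : generically (fun x => root_invariant m (Psi x)).
Hypothesis psi_top : generically (fun x => psi 0 x = top_coef x).

Lemma Psi_translate kap : generically (fun x =>
  forall (s : seq 'rV[int]_n.+1), uniq s -> (forall k, in_support rmul (k - kap) -> k \in s) ->
  forall z, Psi (x + latC kap) z =
    \sum_(k <- s) psi (k - kap) (x + latC kap) * wave (x + rhoC) k z).
Proof.
apply: (generically_imply (generically_translate (latC kap) Psi_expansion)) => x H s us ss z.
rewrite (H [seq k - kap | k <- s]).
- rewrite big_map; apply: eq_bigr => k _.
  by rewrite (addrAC x) wave_translate // subrK.
- by rewrite map_inj_uniq // => k w /addIr.
- move=> k Nk; apply/mapP; exists (k + kap); rewrite ?addrK //.
  by apply: ss; rewrite addrK.
Qed.

(** Candidates for the shifts of the operator, and for the exponents of the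
    functions that such an operator produces from [Psi]. *)
Definition shift_region (c0 a b : int) k : bool :=
  [forall p, c0 <= k ord0 p] && (a <= vsum k <= b).

Definition wave_region (c0 a b : int) k : bool :=
  [forall p, c0 - (up rmul p)%:Z <= k ord0 p] && (a <= vsum k <= b).

Lemma wave_region_enum (c0 a b : int) : exists2 s : seq 'rV[int]_n.+1, uniq s &
  forall k, (k \in s) = wave_region c0 a b k.
Proof.
apply: (@bounded_enum _ (wave_region c0 a b)
  (absz b + \sum_r (absz c0 + up rmul r))%N) => k p /andP[/forallP H /andP[ka kb]].
set S := (\sum_r _)%N.
have low r : - (absz c0 + up rmul r)%N%:Z <= k ord0 r.
  by apply: le_trans (H r); lia.
have Sp : S%:Z = (absz c0 + up rmul p)%N%:Z +
    \sum_(r | r != p) (absz c0 + up rmul r)%N%:Z.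
  by rewrite /S Posz_sum (bigD1 p).
have kS : k ord0 p = vsum k - \sum_(r | r != p) k ord0 r.
  by rewrite /vsum (bigD1 p) //= addrK.
have rest : - \sum_(r | r != p) k ord0 r <= \sum_(r | r != p) (absz c0 + up rmul r)%N%:Z.
  by rewrite -sumrN; apply: ler_sum => r _; rewrite lerNl; exact: low.
have rest0 : 0 <= \sum_(r | r != p) (absz c0 + up rmul r)%N%:Z.
  by apply: sumr_ge0.
have -> : (absz b + S)%N%:Z = (absz b)%:Z + ((absz c0 + up rmul p)%N%:Z +
    \sum_(r | r != p) (absz c0 + up rmul r)%N%:Z) by rewrite PoszD Sp.
move: (low p) rest rest0 kS kb.
move: (k ord0 p) (vsum k) (\sum_(r | r != p) k ord0 r) (absz c0 + up rmul p)%N.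
by move: (\sum_(r | r != p) _) => T kp V U N; lia.
Qed.

Lemma shift_region_wave (c0 a b : int) kap v :
  shift_region c0 a b kap -> in_support rmul (v - kap) -> wave_region c0 a b v.
Proof.
move=> /andP[/forallP c0k ab] Nv.
have := Nv.1; rewrite vsumB => /subr0_eq sv.
rewrite /wave_region sv ab andbT; apply/forallP => p.
have := in_support_ge p Nv; have := c0k p; rewrite mxE [X in _ <= _ + X]mxE.
by move: (v ord0 p) (kap ord0 p) => ? ?; lia.
Qed.

Definition expands (s : seq 'rV[int]_n.+1) (phi : 'rV[C]_n.+1 -> 'rV[C]_n.+1 -> C) : Prop :=
  exists c : 'rV[int]_n.+1 -> 'rV[C]_n.+1 -> C,
  [/\ forall k, meromorphic (c k),
      generically (fun x => forall z, phi x z = \sum_(k <- s) c k x * wave (x + rhoC) k z) &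
      generically (fun x => root_invariant m (phi x))].

Definition diffop0 : diffop R n :=
  @DiffOp R n 0 (fun=> 0) (fun _ _ => 0).

Definition diffop_cons kap (a : 'rV[C]_n.+1 -> C) (D : diffop R n) : diffop R n :=
  @DiffOp R n (dlen D).+1
    (fun t => if unlift ord0 t is Some t' then dshift t' else lat kap)
    (fun t => if unlift ord0 t is Some t' then dcoef t' else a).

Lemma dapp_cons kap a D (F : 'rV[C]_n.+1 -> C) x :
  dapp (diffop_cons kap a D) F x = a x * F (x + latC kap) + dapp D F x.
Proof.
rewrite /dapp /= big_ord_recl /= unlift_none; congr (_ + _).
by apply: eq_bigr => t _; rewrite liftK.
Qed.

(** A function with the invariance of [Psi] and exponents in a wave region is
    obtained from [Psi] by a difference operator.  Its colex-first exponent is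
    either the top exponent of an admissible translate of [Psi], a multiple of
    which is then subtracted, or its coefficient vanishes for lack of room. *)
Lemma eliminate (c0 a b : int) (N : nat) (s : seq 'rV[int]_n.+1) phi :
  size s = N -> uniq s -> (forall k, k \in s -> wave_region c0 a b k) ->
  (forall k v, k \in s -> wave_region c0 a b v -> colex k v -> v \in s) ->
  expands s phi ->
  exists D : diffop R n, [/\ diffop_on_P m D,
    forall t : 'I_(dlen D), exists2 kap, shift_region c0 a b kap & dshift t = lat kap &
    generically (fun x => forall z, phi x z = dapp D (Psi ^~ z) x)].
Proof.
elim: N s phi => [|N IH] s phi sN us sreg sclosed [c [cmer cexp cinv]].
  exists diffop0; split; [by case | by case |].
  apply: (generically_imply cexp) => x H z; rewrite H (size0nil sN) big_nil.
  by rewrite /dapp big_ord0.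
have [|k ks kfirst] := @colex_first _ s; first by case: (s) sN.
pose s' := rem k s.
have s'E v : (v \in s') = (v != k) && (v \in s) by rewrite mem_rem_uniq // inE.
have us' : uniq s' by rewrite rem_uniq.
have s'reg v : v \in s' -> wave_region c0 a b v by rewrite s'E => /andP[_ /sreg].
have s'closed v w : v \in s' -> wave_region c0 a b w -> colex v w -> w \in s'.
  rewrite !s'E => /andP[vk vs] wreg vw; rewrite (sclosed v w vs wreg vw) andbT.
  apply: contraTneq vw => ->; apply/negP => vk'.
  by have := colex_trans vk' (kfirst v vs vk); rewrite colex_irr.
have sN' : size s' = N by rewrite size_rem // sN.
have split_sum (F : 'rV[int]_n.+1 -> C) : \sum_(v <- s) F v = F k + \sum_(v <- s') F v.
  by rewrite (perm_big _ (perm_to_rem ks)) big_cons.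
have [kK|kK] := boolP (shift_region c0 a b k); last first.
  apply: (IH s') => //; exists c; split=> //.
  have gen_s := @generically_all_in R n _ s (fun w x => edge_generic m l (x + rhoC) w)
    (fun w _ => generically_edge_generic m_gt0 q_not_root w).
  apply: (generically_imply (generically_and gen_s (generically_and cexp cinv))).
  move=> x [gx [ex ix]] z; rewrite ex split_sum.
  have [->|ck] := eqVneq (c k x) 0; first by rewrite mul0r add0r.
  case/negP: kK; pose cs v := if v \in s then c v x else 0.
  have cE z' : phi x z' = \sum_(v <- s) cs v * wave (x + rhoC) v z'.
    by rewrite ex [RHS]big_seq big_seq; apply: eq_bigr => v; rewrite /cs => ->.
  have sub v : cs v != 0 -> v \in s by rewrite /cs; case: ifP; rewrite ?eqxx.
  have inv_s : root_invariant m (fun z' => \sum_(v <- s) cs v * wave (x + rhoC) v z').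
    by move: ix; congr (root_invariant m _); apply/funext.
  have ckx : cs k != 0 by rewrite /cs ks.
  have k_first v : v \in s -> ~~ colex v k.
    have [->|vk vs] := eqVneq v k; first by rewrite colex_irr.
    by apply/negP => /colex_trans /(_ (kfirst v vs vk)); rewrite colex_irr.
  have room := room_below_first m_gt0 q_not_root us sub inv_s gx ckx k_first.
  have /andP[_ ab] := sreg k ks; rewrite /shift_region ab andbT; apply/forallP => p.
  have [v /sreg/andP[/forallP /(_ p) vp _] vk] := room p.
  by have := le_trans vp vk; rewrite lerD2r.
(* the multiple of the translate of [Psi] by [k] that cancels the wave of [k] *)
pose g x := c k x / top_coef (x + latC k).
have gmer : meromorphic g.
  apply: meromorphicM; first exact: cmer.
  rewrite (_ : (fun x => (top_coef (x + latC k))^-1) =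
    fun x => 1 / top_coef (x + latC k)); last by apply/funext => x; rewrite div1r.
  apply: meromorphic_quotient; first by move=> x; exact: holomorphic_cst.
    by move=> x; apply: holomorphic_translate; exact: holomorphic_top_coef.
  exact: (generically_translate (latC k) (generically_top_coef n m_gt0 q_not_root)).
pose phi' x z := phi x z - g x * Psi (x + latC k) z.
have [|D [DP Dsh Dapp]] := IH s' phi' sN' us' s'reg s'closed.
  exists (fun v x => c v x - g x * psi (v - k) (x + latC k)); split.
  - move=> v; rewrite (_ : (fun x => _) =
      fun x => c v x + (-1) * (g x * psi (v - k) (x + latC k))).
      apply: meromorphicD => //; apply: meromorphicM; first exact: meromorphic_cst.
      by apply: meromorphicM => //; exact: meromorphic_translate.
    by apply/funext => x; rewrite mulN1r.
  - apply: (generically_imply (generically_and cexp (generically_and (Psi_translate k)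
      (generically_and (generically_translate (latC k) psi_top)
        (generically_translate (latC k) (generically_top_coef n m_gt0 q_not_root)))))).
    move=> x [ex [et [pt tn]]] z; rewrite /phi' ex (et s) //; last first.
      move=> v Nv; have [->//|vk] := eqVneq v k.
      apply: (sclosed k) => //; first exact: shift_region_wave Nv.
      have := in_support_first Nv; rewrite -(colexD2l _ _ k) addr0 addrC subrK.
      by have := colex_total vk; case: (colex v k).
    rewrite mulr_sumr -sumrB split_sum subrr pt /g mulrA divfK // subrr add0r.
    by apply: eq_bigr => v _; rewrite mulrBl mulrA.
  - apply: (generically_imply (generically_and cinv
      (generically_translate (latC k) Psi_invariant))) => x [i1 i2] p r j z pr jm zz.
    by rewrite /phi' (i1 p r j) // (i2 p r j).
exists (diffop_cons k g D); split.
- move=> t; rewrite /diffop_cons /=; case: (unlift ord0 t) => [t'|]; first exact: DP.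
  by split=> //; apply/latP_lat; exists k.
- move=> t; rewrite /diffop_cons /=; case: (unlift ord0 t) => [t'|]; first exact: Dsh.
  by exists k.
apply: (generically_imply Dapp) => x H z.
by rewrite dapp_cons -H /phi' addrC subrK.
Qed.

(** The product of [f] and [Psi] inherits the invariance of both, and
    its exponents are sums of exponents of [f] and of [Psi]. *)
Lemma operator_of_function (I : Type) (t : seq I) (kap : I -> 'rV[int]_n.+1) (d : I -> C)
    (c0 a b : int) (f : 'rV[C]_n.+1 -> C) :
  (forall i, shift_region c0 a b (kap i)) ->
  (forall z, f z = \sum_(i <- t) d i * qpow l (2 * dotp (latC (kap i)) z)) ->
  root_invariant m f ->
  exists D : diffop R n, [/\ diffop_on_P m D,
    forall t : 'I_(dlen D), exists2 kap, shift_region c0 a b kap & dshift t = lat kap &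
    generically (fun x => forall z, f z * Psi x z = dapp D (Psi ^~ z) x)].
Proof.
move=> kapK fE finv; have [s us sE] := wave_region_enum c0 a b.
apply: (@eliminate c0 a b (size s) s (fun x z => f z * Psi x z)) => //.
- by move=> k; rewrite sE.
- by move=> k v _ vreg _; rewrite sE.
exists (fun v x => \sum_(i <- t) d i * psi (v - kap i) x); split.
- move=> v; apply: meromorphic_sum => i; apply: meromorphicM => //.
  exact: meromorphic_cst.
- apply: (generically_imply Psi_expansion) => x H z.
  rewrite fE mulr_suml; under [RHS]eq_bigr do rewrite mulr_suml.
  rewrite exchange_big; apply: eq_bigr => i _.
  rewrite (H [seq v - kap i | v <- s]); first last.
  + move=> k Nk; apply/mapP; exists (k + kap i); rewrite ?addrK // sE.
    by apply: (shift_region_wave (kapK i)); rewrite addrK.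
  + by rewrite map_inj_uniq // => v w /addIr.
  rewrite big_map mulr_sumr; apply: eq_bigr => v _.
  have -> : wave (x + rhoC) v z = qpow l (2 * dotp (latC (kap i)) z) *
      wave (x + rhoC) (v - kap i) z by rewrite wave_mul subrK.
  by ring.
- apply: (generically_imply Psi_invariant) => x ix p r j z pr jm zz.
  by rewrite (finv p r j) // (ix p r j).
Qed.

(** A difference operator is determined by its action on [Psi]: the
    colex-first shift of an operator annihilating [Psi] would contribute the
    top exponent of a translate of [Psi], which nothing else can cancel. *)
Lemma Psi_separates (I : finType) (kap : I -> 'rV[int]_n.+1) (d : I -> 'rV[C]_n.+1 -> C) :
  generically (fun x => forall z, \sum_i d i x * Psi (x + latC (kap i)) z = 0) ->
  generically (fun x => forall k, \sum_(i | kap i == k) d i x = 0).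
Proof.
move=> H0.
have H1 := generically_finType (fun i => Psi_translate (kap i)).
have H2 := generically_finType (fun i => generically_translate (latC (kap i)) psi_top).
have H3 := generically_finType (fun i => generically_translate (latC (kap i))
  (generically_top_coef n m_gt0 q_not_root)).
apply: (generically_imply (generically_and H0 (generically_and H1 (generically_and H2 H3)))).
move=> x {H0 H1 H2 H3} [H0 [H1 [H2 H3]]].
pose A k := \sum_(i | kap i == k) d i x.
have fibres (g : 'rV[int]_n.+1 -> C) :
    \sum_i d i x * g (kap i) = \sum_(k <- undup (map kap (index_enum I))) A k * g k.
  rewrite (sum_fibres kap); apply: eq_bigr => k _.
  by rewrite mulr_suml; apply: eq_bigr => i /eqP ->.
have [B uB BE] := @in_support_enum n m.
pose s := undup [seq kap i + w | i <- index_enum I, w <- B].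
have sN i k : in_support rmul (k - kap i) -> k \in s.
  move=> Nk; rewrite mem_undup; apply/allpairsP; exists (i, k - kap i) => /=.
  by rewrite mem_index_enum BE (addrC (kap i)) subrK; split=> //; apply/asboolP.
pose cf k := \sum_i d i x * psi (k - kap i) (x + latC (kap i)).
have cf0 k : k \in s -> cf k = 0.
  apply: (waves_independent m_gt0 q_not_root (xi := x + rhoC) (undup_uniq _)) => z.
  rewrite -[RHS](H0 z); under eq_bigr do rewrite mulr_suml.
  rewrite exchange_big; apply: eq_bigr => i _; rewrite (H1 i s (undup_uniq _) (sN i)).
  by rewrite mulr_sumr; apply: eq_bigr => k' _; rewrite mulrA.
pose T := [seq k <- undup (map kap (index_enum I)) | A k != 0].
have [T0|/colex_first[k0 k0T k0first]] := eqVneq T [::].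
  move=> k; have [kI|kI] := boolP (k \in map kap (index_enum I)); last first.
    rewrite big1 // => i /eqP ik; case/negP: kI; rewrite -ik.
    by apply: map_f; rewrite mem_index_enum.
  apply/eqP/negPn/negP => Ak; suff: k \in T by rewrite T0.
  by rewrite mem_filter Ak mem_undup.
move: (k0T); rewrite mem_filter mem_undup => /andP[Ak0 /mapP[i0 _ i0E]].
have : cf k0 = 0.
  by apply: cf0; apply: (sN i0); rewrite i0E subrr; exact: in_support0.
rewrite /cf (fibres (fun k => psi (k0 - k) (x + latC k))).
rewrite (bigD1_seq k0) ?undup_uniq //=; last by rewrite mem_undup i0E; apply: map_f; rewrite mem_index_enum.
rewrite big_seq_cond big1 => [|k /andP[kI kk0]].
  rewrite addr0 subrr i0E H2 => /eqP; rewrite mulf_eq0 (negPf (H3 i0)) orbF.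
  by rewrite -i0E (negPf Ak0).
have [->|Ak] := eqVneq (A k) 0; first by rewrite mul0r.
have kT : k \in T by rewrite mem_filter Ak.
have [->|/psi_support/in_support_first] := eqVneq (psi (k0 - k) (x + latC k)) 0.
  by rewrite mulr0.
by rewrite -(colexD2l _ _ k) addr0 addrC subrK (k0first k kT kk0).
Qed.

Lemma Psi_separates_functions (I : finType) (kap : I -> 'rV[int]_n.+1)
    (d : I -> 'rV[C]_n.+1 -> C) :
  generically (fun x => forall z, \sum_i d i x * Psi (x + latC (kap i)) z = 0) ->
  generically (fun x => forall F : 'rV[C]_n.+1 -> C,
    \sum_i d i x * F (x + latC (kap i)) = 0).
Proof.
move=> /Psi_separates /generically_imply; apply=> x H F.
rewrite (sum_fibres kap) big1 // => k _.
transitivity (\sum_(i | kap i == k) d i x * F (x + latC k)).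
  by apply: eq_bigr => i /eqP ->.
by rewrite -mulr_suml H mul0r.
Qed.

End Elimination.

(** * Coefficients at the vertices of the polytope *)

Section VertexCoefficients.
Variables (R : realType) (n m : nat) (l : R[i]).
Hypothesis m_gt0 : (0 < m)%N.
Hypothesis q_not_root : forall k, (0 < k)%N -> qpow l 1 ^+ k != 1.
Local Notation C := R[i].
Local Notation wave := (wave m l).
Local Notation rmul := (@rmul n m).
Local Notation hlen := (@hlen R n m).
Local Notation bsq := (@bsq R n m).
Local Notation lat := (lat R m).
Local Notation gfac := (@gfac R n m l).
Local Notation rhoC := (toC (rho R n m)).
Local Notation top_coef := (@top_coef R n m l).
Local Notation xc p x := (lcoord m p x).
Implicit Types (k v : 'rV[int]_n.+1) (x z : 'rV[C]_n.+1) (p r i : 'I_n.+1).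

(** One edge relation for each step of the path [edge_vertex]. *)
Lemma edge_path_coefficient x (s : seq 'rV[int]_n.+1) (c : 'rV[int]_n.+1 -> C) i (j : nat) :
  uniq s -> (forall k, c k != 0 -> k \in s) -> (forall k, c k != 0 -> in_support rmul k) ->
  root_invariant m (fun z => \sum_(k <- s) c k * wave (x + rhoC) k z) -> (j <= i)%N ->
  c (edge_vertex rmul i j) * \prod_(t < n.+1 | (j <= t < i)%N) gfac t i (xc t x - xc i x) =
  c 0 * \prod_(t < n.+1 | (j <= t < i)%N) gfac t i (xc i x - xc t x).
Proof.
move=> us cs csupp inv ji.
have [d dE] : exists d, (i - j)%N = d by eexists.
elim: d j ji dE => [|d IH] j ji dE.
  have -> : j = i by apply/eqP; rewrite eqn_leq ji -subn_eq0 dE.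
  by rewrite edge_vertex_top !big1 // => t /andP[it]; rewrite ltnNge it.
have jlti : (j < i)%N by rewrite -subn_gt0 dE.
pose J := Ordinal (ltn_trans jlti (ltn_ord i)).
have Ji : (J < i)%N by [].
have step (F : 'I_n.+1 -> C) : \prod_(t < n.+1 | (j <= t < i)%N) F t =
    F J * \prod_(t < n.+1 | (j < t < i)%N) F t.
  rewrite (bigD1 J) /= ?leqnn //; congr (_ * _); apply: eq_bigl => t.
  by rewrite -val_eqE /=; case: (ltngtP j t); rewrite ?andbT ?andbF.
have {}IH := IH j.+1 jlti; rewrite !step.
have seg (t : int) : c (edge_vertex rmul i J.+1 + t *: rt J i) != 0 ->
    - (rmul J i)%:Z <= t <= 0.
  by move=> /csupp; exact: edge_vertex_segment.
have := edge_relation m_gt0 q_not_root us cs Ji inv seg.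
cbv zeta; rewrite edge_slope // opprB -edge_vertex_step // => E.
rewrite mulrA -E mulrAC [X in X * _]IH; last by rewrite subnS dE.
by ring.
Qed.

Lemma gfacC p r D : gfac p r D = gfac r p D.
Proof. by rewrite /gfac /rmul /hlen orbC addrC. Qed.

(** The factors of a vertex coefficient that do and do not involve the [p]-th
    coordinate; translation by the [p]-th basis vector fixes the latter. *)
Definition vertex_factor p x : C := \prod_(r | r != p) gfac p r (xc p x - xc r x).

Definition other_factor p x : C :=
  \prod_(u : 'I_n.+1 * 'I_n.+1 | [&& (u.1 < u.2)%N, u.2 != p & u.1 != p])
    gfac u.1 u.2 (xc u.1 x - xc u.2 x).

Lemma top_coef_split p x : top_coef x =
  \prod_(t < n.+1 | (t < p)%N) gfac t p (xc t x - xc p x) *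
  (\prod_(r < n.+1 | (p < r)%N) gfac p r (xc p x - xc r x) * other_factor p x).
Proof.
rewrite /top_coef (bigID (fun u : 'I_n.+1 * 'I_n.+1 => u.2 == p)) /=; congr (_ * _).
  rewrite (reindex_onto (fun t : 'I_n.+1 => (t, p)) fst) /=.
    by apply: eq_bigl => t; rewrite !eqxx !andbT.
  by case=> a b /= /andP[_ /eqP ->].
rewrite (bigID (fun u : 'I_n.+1 * 'I_n.+1 => u.1 == p)) /=; congr (_ * _).
  rewrite (reindex_onto (fun t : 'I_n.+1 => (p, t)) snd) /=.
    apply: eq_bigl => t; rewrite !eqxx !andbT.
    by case: ltnP => //= pt; rewrite -val_eqE /= gtn_eqF.
  by case=> a b /= /andP[_ /eqP ->].
by apply: eq_bigl => u; rewrite -!andbA.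
Qed.

Lemma vertex_factor_split p x : vertex_factor p x =
  \prod_(t < n.+1 | (t < p)%N) gfac t p (xc p x - xc t x) *
  \prod_(r < n.+1 | (p < r)%N) gfac p r (xc p x - xc r x).
Proof.
rewrite /vertex_factor (bigID (fun r : 'I_n.+1 => (r < p)%N)) /=; congr (_ * _).
  apply: eq_big => [t|t _]; last exact: gfacC.
  by rewrite -val_eqE /=; case: ltngtP.
by apply: eq_bigl => t; rewrite -val_eqE /=; case: ltngtP.
Qed.

(** The coefficient at the vertex where the [p]-th coordinate is largest is
    the top coefficient with the roles of the coordinates permuted so that
    [p] comes first. *)
Lemma vertex_coefficient x (s : seq 'rV[int]_n.+1) (c : 'rV[int]_n.+1 -> C) p :
  uniq s -> (forall k, c k != 0 -> k \in s) -> (forall k, c k != 0 -> in_support rmul k) ->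
  root_invariant m (fun z => \sum_(k <- s) c k * wave (x + rhoC) k z) ->
  c 0 = top_coef x -> top_coef x != 0 ->
  c (edge_vertex rmul p 0) = vertex_factor p x * other_factor p x.
Proof.
move=> us cs csupp inv c0 top0.
have := edge_path_coefficient us cs csupp inv (leq0n p).
rewrite c0; move: top0; rewrite (top_coef_split p) vertex_factor_split.
set U := \prod_(t < n.+1 | _) _; set W := \prod_(t < n.+1 | _) _.
set V := \prod_(t < n.+1 | _) _ => UW; have U0 : U != 0.
  by move: UW; rewrite mulf_eq0 negb_or => /andP[].
by move=> E; apply: (mulIf U0); rewrite E; ring.
Qed.

Lemma lcoord_delta p r : lcoord m r (toC (lat (delta_mx ord0 p))) = bsq r * (r == p)%:R.
Proof. by rewrite lcoord_lat // mxE eqxx /= natz -pmulrn. Qed.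

Lemma other_factor_translate p x :
  other_factor p (x + toC (lat (delta_mx ord0 p))) = other_factor p x.
Proof.
apply: eq_bigr => u /and3P[_ /negPf u2 /negPf u1].
by rewrite !lcoordD !lcoord_delta u1 u2 !mulr0 !addr0.
Qed.

(** The quotient of consecutive values of [gfac], a product that telescopes:
    the contribution of [r] to the [p]-th coefficient of [Dtilde]. *)
Definition coef_ratio p r x : C :=
  qbr l (xc p x - xc r x - hlen p r * (rmul p r)%:R) /
  qbr l (xc p x - xc r x + bsq p - hlen p r).

Lemma gfac_shift p r y : p != r ->
  gfac p r y * qbr l (y + bsq p - hlen p r) =
  gfac p r (y + bsq p) * qbr l (y - hlen p r * (rmul p r)%:R).
Proof.
move=> pr; rewrite /gfac.
have [|big] := boolP ((p == ord_max) || (r == ord_max)).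
  rewrite /rmul => ->; rewrite !big_nat1 !mulr1.
  have -> : qbr l (y - hlen p r) = - qbr l (hlen p r - y) by rewrite -qbrN opprB.
  have -> : qbr l (y + bsq p - hlen p r) = - qbr l (hlen p r - (y + bsq p)).
    by rewrite -qbrN opprB.
  by ring.
move: (big); rewrite negb_or => /andP[/negPf p_m /negPf r_m].
have h1 : hlen p r = 1 by rewrite /hlen /bsq p_m r_m; field.
have b1 : bsq p = 1 by rewrite /bsq p_m.
have mE : rmul p r = m by rewrite /rmul (negPf big).
rewrite mE h1 b1 !mul1r addrK; pose F (j : nat) := qbr l (j%:R - y).
have -> : \prod_(1 <= j < m.+1) qbr l (1 * j%:R - y) = \prod_(1 <= j < m.+1) F j.
  by apply: eq_bigr => j _; rewrite mul1r.
have -> : \prod_(1 <= j < m.+1) qbr l (1 * j%:R - (y + 1)) = \prod_(0 <= j < m) F j.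
  rewrite big_add1; apply: eq_bigr => j _; rewrite mul1r -natr1.
  by congr (qbr l _); ring.
have -> : qbr l y = - F 0%N by rewrite /F sub0r qbrN opprK.
have -> : qbr l (y - m%:R) = - F m by rewrite /F -qbrN opprB.
have key : F 0%N * \prod_(1 <= j < m.+1) F j = \prod_(0 <= j < m) F j * F m.
  by rewrite -big_ltn // big_nat_recr.
by rewrite !mulrN -key mulrC.
Qed.

Lemma generically_other_lcoord p : generically (fun x => forall r, r != p ->
  gfac p r (xc p x - xc r x + bsq p) != 0 /\
  qbr l (xc p x - xc r x + bsq p - hlen p r) != 0).
Proof.
apply: generically_finType => r; have [rp|rp] := eqVneq r p.
  exact: generically_all_points.
have pr : p != r by rewrite eq_sym.
have H1 := generically_gfac m_gt0 q_not_root p r (bsq p) pr.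
have H2 := generically_qbr m_gt0 q_not_root (bsq p - hlen p r) pr.
by apply: (generically_imply (generically_and H1 H2)) => x [? ?] _; split=> //; rewrite -addrA.
Qed.

Lemma meromorphic_coef_ratio p r : r != p -> meromorphic (coef_ratio p r).
Proof.
move=> rp; have pr : p != r by rewrite eq_sym.
have hol c x : holomorphic_at (fun x => qbr l (xc p x - xc r x + c)) x.
  apply: holomorphic_qbr; apply: holomorphicD; last exact: holomorphic_cst.
  by apply: holomorphicB; exact: holomorphic_lcoord.
apply: meromorphic_quotient; first by move=> x; exact: hol.
  move=> x; rewrite (_ : (fun x => _) = fun x => qbr l (xc p x - xc r x + (bsq p - hlen p r))).
    exact: hol.
  by apply/funext => y; rewrite addrA.
by apply: (generically_imply (generically_other_lcoord p)) => x /(_ r rp)[].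
Qed.

(** The coefficients of [mfrak]. *)
Definition leading_coef p : C := if p == ord_max then qbr l 1 / qbr l m%:R else 1.

Lemma Dtilde_coef p :
  dcoef (d := Dtilde n m l) p = fun x => leading_coef p * \prod_(r | r != p) coef_ratio p r x.
Proof.
apply/funext => x; rewrite /Dtilde /=.
case: unliftP => [i ->|->]; rewrite big_mkcond big_ord_recr /=.
  have li : (lift ord_max i == ord_max) = false by rewrite eq_sym; exact/negbTE/neq_lift.
  rewrite /leading_coef li eq_sym li /= mul1r mulrC.
  congr (_ * _).
    have ilt : (lift ord_max i < @ord_max n)%N by rewrite lift_max; exact: ltn_ord.
    rewrite /coef_ratio rmul_max (hlen_lt _ _ ilt) bsq_lift bsq_max.
    rewrite lcoord_lift lcoord_max.
    by congr (qbr l _ / qbr l _); field.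
  rewrite big_mkcond; apply: eq_bigr => j _; rewrite widen_lift (inj_eq lift_inj).
  case: ifP => // ij; rewrite /coef_ratio rmul_lift /hlen !bsq_lift !lcoord_lift.
  by congr (qbr l _ / qbr l _); field.
rewrite eqxx mulr1 /amr_last /leading_coef eqxx; congr (_ * _); apply: eq_bigr => j _.
have jl : (lift ord_max j == ord_max) = false by rewrite eq_sym; exact/negbTE/neq_lift.
rewrite widen_lift jl /coef_ratio /rmul eqxx /= /hlen bsq_lift bsq_max.
rewrite lcoord_lift lcoord_max.
by congr (qbr l _ / qbr l _); field.
Qed.

Lemma meromorphic_Dtilde p : meromorphic (dcoef (d := Dtilde n m l) p).
Proof.
rewrite Dtilde_coef; apply: meromorphicM; first exact: meromorphic_cst.
by apply: meromorphic_prod => r; exact: meromorphic_coef_ratio.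
Qed.

End VertexCoefficients.

(** * The deformed Macdonald-Ruijsenaars operator *)

Section DeformedOperator.
Variables (R : realType) (n m : nat) (l : R[i]).
Hypothesis m_gt0 : (0 < m)%N.
Hypothesis q_not_root : forall k, (0 < k)%N -> qpow l 1 ^+ k != 1.
Local Notation C := R[i].
Local Notation wave := (wave m l).
Local Notation rmul := (@rmul n m).
Local Notation bsq := (@bsq R n m).
Local Notation hlen := (@hlen R n m).
Local Notation gfac := (@gfac R n m l).
Local Notation lat := (lat R m).
Local Notation latC k := (toC (lat k)).
Local Notation rhoC := (toC (rho R n m)).
Local Notation top_coef := (@top_coef R n m l).
Local Notation leading_coef := (@leading_coef R n m l).
Local Notation vertex_factor := (@vertex_factor R n m l).
Local Notation other_factor := (@other_factor R n m l).
Local Notation unit_vec p := (delta_mx ord0 p : 'rV[int]_n.+1).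
Implicit Types (k v : 'rV[int]_n.+1) (x z : 'rV[C]_n.+1) (p r : 'I_n.+1).

Lemma mfrakE q z : cexp l = q ->
  mfrak n m q l z = \sum_p leading_coef p * qpow l (2 * lcoord m p z).
Proof.
move=> lq; have q1 : qpow l 1 = q by rewrite /qpow mul1r.
rewrite /mfrak big_ord_recr /=; congr (_ + _).
  apply: eq_bigr => i _; rewrite widen_lift lcoord_lift /leading_coef.
  by rewrite eq_sym (negPf (neq_lift _ _)) mul1r.
rewrite /leading_coef eqxx lcoord_max mulrA; congr (_ * _).
by rewrite /qbr !qpowN qpow_mulrn q1.
Qed.

Lemma leading_sum_shift (a : 'I_n.+1) (j : nat) z :
  \sum_p leading_coef p * qpow l (2 * lcoord m p (z + toC (j%:R *: lat_basis R m a))) =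
  \sum_p leading_coef p * qpow l (2 * lcoord m p z) +
  leading_coef a * (qpow l (2 * lcoord m a z) * (qpow l (2 * j%:R * bsq a) - 1)).
Proof.
have E p : lcoord m p (z + toC (j%:R *: lat_basis R m a)) =
    lcoord m p z + j%:R * bsq p * (p == a)%:R.
  by rewrite lcoordD toCZ lcoordZ rmorph_nat -lat_delta lcoord_delta // mulrA.
rewrite (bigD1 a) //= [in RHS](bigD1 a) //= E eqxx mulr1 mulrDr qpowD mulrA.
rewrite (eq_bigr (fun p => leading_coef p * qpow l (2 * lcoord m p z))) => [|p /negPf pa].
  by rewrite mulrA; ring.
by rewrite E pa mulr0 addr0.
Qed.

Lemma mfrak_quasi_invariant q : cexp l = q -> quasi_invariant m l (mfrak n m q l).
Proof.
move=> lq; split=> [i j s z _ _ zz|i z zz].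
  rewrite !mfrakE // -!(lat_basis_lift R m) !leading_sum_shift /leading_coef.
  rewrite ![lift _ _ == _]eq_sym !(negPf (neq_lift _ _)) !bsq_lift !lcoord_lift.
  by rewrite zz.
rewrite !mfrakE // -(lat_basis_lift R m) -lat_basis_max -[lat_basis _ _ (lift _ _)]scale1r.
rewrite -[lat_basis _ _ ord_max]scale1r !(leading_sum_shift _ 1).
rewrite /leading_coef eqxx eq_sym (negPf (neq_lift _ _)) bsq_lift bsq_max !mul1r.
rewrite lcoord_lift lcoord_max [2 * (_ * z _ _)]mulrA -zz qpowD !mulr1.
have mm0 := qbr_nat_neq0 q_not_root m_gt0.
have E a : qpow l (2 * a) - 1 = qpow l a * qbr l a.
  by rewrite /qbr mulrBr -!qpowD subrr qpow0; congr (qpow l _ - _); ring.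
rewrite -[X in qpow l X - 1](mulr1 2) !E [qpow l (1 - _)]qpowB.
have qm0 := qpow_neq0 l m%:R.
by congr (_ + _); field; rewrite qm0 mm0.
Qed.

Lemma mfrak_Rtilde q : cexp l = q -> Rtilde m l (mfrak n m q l).
Proof.
move=> lq; split; last exact: mfrak_quasi_invariant.
exists [seq lat_basis R m p | p <- index_enum 'I_n.+1],
  (fun nu => \sum_(p | lat_basis R m p == nu) leading_coef p).
split=> [nu /mapP[p _ ->]|z].
  by apply/latP_lat; exists (unit_vec p); rewrite lat_delta.
rewrite mfrakE // big_map; apply: eq_bigr => p _.
rewrite basis_dotp (big_pred1 p) // => r /=.
rewrite -!lat_delta (inj_eq (lat_inj m_gt0)).
apply/eqP/eqP => [/rowP /(_ p)|->//]; rewrite !mxE !eqxx /=.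
by case: (eqVneq p r).
Qed.

Lemma simplex_vertex k : shift_region 0 1 1 k -> exists p, k = unit_vec p.
Proof.
move=> /andP[/forallP k0 ab].
have s1 : vsum k = 1 by apply/eqP; rewrite eq_le andbC.
have [p kp] : exists p, k ord0 p != 0.
  case: (pickP (fun p => k ord0 p != 0)) => [p|H]; first by exists p.
  by move: s1; rewrite /vsum big1 // => p _; apply/eqP; have /negbFE := H p.
have rest0 : 0 <= \sum_(r | r != p) k ord0 r by apply: sumr_ge0 => r _.
have E : k ord0 p + \sum_(r | r != p) k ord0 r = 1 by rewrite -s1 /vsum [RHS](bigD1 p).
have kp1 : 1 <= k ord0 p by have := k0 p; rewrite le0r (negPf kp).
have z : \sum_(r | r != p) k ord0 r = 0.
  by move: rest0 E kp1; move: (k ord0 p) (\sum_(r | r != p) _) => ? ?; lia.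
exists p; apply/rowP => r; rewrite mxE eqxx /=.
have [->|rp] := eqVneq r p; first by rewrite -E z addr0.
by apply/eqP; move/eqP: z; rewrite psumr_eq0 // => /allP/(_ r (mem_index_enum r))/implyP/(_ rp).
Qed.

Variables (Psi : 'rV[C]_n.+1 -> 'rV[C]_n.+1 -> C).
Variable psi : 'rV[int]_n.+1 -> 'rV[C]_n.+1 -> C.
Hypothesis psi_meromorphic : forall k, meromorphic (psi k).
Hypothesis psi_support : forall k x, psi k x != 0 -> in_support rmul k.
Hypothesis Psi_expansion : generically (fun x =>
  forall (s : seq 'rV[int]_n.+1), uniq s -> (forall k, in_support rmul k -> k \in s) ->
  forall z, Psi x z = \sum_(k <- s) psi k x * wave (x + rhoC) k z).
Hypothesis Psi_invariant : generically (fun x => root_invariant m (Psi x)).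
Hypothesis psi_top : generically (fun x => psi 0 x = top_coef x).

Lemma psi_vertex p : generically (fun x =>
  psi (edge_vertex rmul p 0) x = vertex_factor p x * other_factor p x).
Proof.
apply: (generically_imply (generically_and Psi_expansion (generically_and Psi_invariant
  (generically_and psi_top (generically_top_coef n m_gt0 q_not_root))))).
move=> x [ex [ix [tx t0]]]; have [B uB BE] := @in_support_enum n m.
have BN k : in_support rmul k -> k \in B by rewrite BE => ?; exact/asboolP.
have cB k : psi k x != 0 -> k \in B by move=> /psi_support; exact: BN.
have cN k : psi k x != 0 -> in_support rmul k by exact: psi_support.
have inv : root_invariant m (fun z => \sum_(k <- B) psi k x * wave (x + rhoC) k z).
  by move: ix; congr (root_invariant m _); apply/funext => z; exact: ex.
exact: (vertex_coefficient m_gt0 q_not_root p uB cB cN inv tx t0).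
Qed.

Lemma edge_vertex_last p : edge_vertex rmul p 0 ord0 p = (down rmul p)%:Z.
Proof. by rewrite mxE eqxx. Qed.

(** The operator attached to [mfrak] involves only the shifts by the basis
    vectors.  Each of its coefficients is read off at the vertex of the
    polytope extremal in the direction of that basis vector, where only one
    term on either side contributes. *)
Lemma Dtilde_eigen q : cexp l = q ->
  generically (fun x => forall z, mfrak n m q l z * Psi x z = dapp (Dtilde n m l) (Psi ^~ z) x).
Proof.
move=> lq.
have fE z : mfrak n m q l z = \sum_(p <- index_enum 'I_n.+1)
    leading_coef p * qpow l (2 * dotp (latC (unit_vec p)) z).
  rewrite mfrakE //; apply: eq_bigr => p _; congr (_ * qpow l (2 * _)).
  by rewrite lat_delta basis_dotp.
have unitK p : shift_region 0 1 1 (unit_vec p).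
  by apply/andP; split; [apply/forallP => r; rewrite mxE | rewrite vsum_delta].
have finv := quasi_invariant_root (mfrak_quasi_invariant lq).
have [D [DP Dsh Dapp]] := operator_of_function m_gt0 q_not_root psi_meromorphic
  Psi_expansion Psi_invariant psi_top unitK fE finv.
have {}Dsh (t : 'I_(dlen D)) : exists p, dshift t = lat (unit_vec p).
  by have [k /simplex_vertex[p ->] ->] := Dsh t; exists p.
have [pt ptE] := fin_all_exists Dsh.
pose A p x := \sum_(t | pt t == p) dcoef t x.
have dappE F x : dapp D F x = \sum_p A p x * F (x + latC (unit_vec p)).
  rewrite /dapp (partition_big pt xpredT) //; apply: eq_bigr => p _.
  by rewrite mulr_suml; apply: eq_bigr => t /eqP <-; rewrite ptE.
have H1 := generically_finType (fun p => Psi_translate Psi_expansion (unit_vec p)).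
have H2 := generically_finType psi_vertex.
have H3 := generically_finType (fun p => generically_translate (latC (unit_vec p)) (psi_vertex p)).
have H4 := generically_finType (fun p => generically_other_lcoord m_gt0 q_not_root p).
have H5 := generically_top_coef n m_gt0 q_not_root.
have H := generically_and Dapp (generically_and Psi_expansion
  (generically_and H1 (generically_and H2 (generically_and H3 (generically_and H4 H5))))).
apply: (generically_imply H) => x {H H1 H2 H3 H4 H5} [Dx [ex [H1 [H2 [H3 [H4 H5]]]]]] z; rewrite Dx dappE.
apply: eq_bigr => p _; congr (_ * Psi (x + toC _) z); last exact: lat_delta.
rewrite Dtilde_coef //.
have [s us sE] := wave_region_enum n m_gt0 0 1 1.
have sN r k : in_support rmul (k - unit_vec r) -> k \in s.
  by rewrite sE; exact: shift_region_wave.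
pose cf k := \sum_r (A r x * psi (k - unit_vec r) (x + latC (unit_vec r)) -
    leading_coef r * psi (k - unit_vec r) x).
have coefs k : k \in s -> cf k = 0.
  apply: (waves_independent m_gt0 q_not_root (xi := x + rhoC) us) => z'.
  transitivity (dapp D (Psi ^~ z') x - mfrak n m q l z' * Psi x z'); last first.
    by rewrite -Dx subrr.
  rewrite dappE fE mulr_suml -sumrB; under eq_bigr do rewrite mulr_suml.
  rewrite exchange_big; apply: eq_bigr => r _.
  rewrite (H1 r s us (sN r)) (ex [seq k' - unit_vec r | k' <- s]); first last.
  - move=> k' Nk; apply/mapP; exists (k' + unit_vec r); rewrite ?addrK //.
    by apply: (sN r); rewrite addrK.
  - by rewrite map_inj_uniq // => ? ? /addIr.
  rewrite big_map 2!mulr_sumr -sumrB; apply: eq_bigr => v _.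
  have -> : wave (x + rhoC) v z' = qpow l (2 * dotp (latC (unit_vec r)) z') *
      wave (x + rhoC) (v - unit_vec r) z' by rewrite wave_mul subrK.
  by ring.
have [T'0 den0] : vertex_factor p (x + latC (unit_vec p)) != 0 /\
    \prod_(r | r != p) qbr l (lcoord m p x - lcoord m r x + bsq p - hlen p r) != 0.
  split; apply/prodf_neq0 => r rp; have [g0 d0] := H4 p r rp; last exact: d0.
  rewrite !lcoordD !lcoord_delta // eqxx (negPf rp) mulr1 mulr0 addr0.
  by rewrite addrAC.
have O0 : other_factor p x != 0.
  by move: H5; rewrite (top_coef_split m l p) !mulf_eq0 !negb_or => /andP[_ /andP[]].
have vert' := H3 p; rewrite /= other_factor_translate // in vert'.
have vN : in_support rmul (edge_vertex rmul p 0).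
  apply: (@psi_support _ (x + latC (unit_vec p))); rewrite vert'.
  exact: mulf_neq0.
have vs : edge_vertex rmul p 0 + unit_vec p \in s by apply: (sN p); rewrite addrK.
have := coefs _ vs; rewrite /cf (bigD1 p) //= addrK big1 => [|r rp]; last first.
  have far y : psi (edge_vertex rmul p 0 + unit_vec p - unit_vec r) y = 0.
    apply/eqP/negPn/negP => /psi_support/(in_support_le p); apply/negP.
    rewrite !mxE -(edge_vertex_last p) mxE !eqxx /= [p == r]eq_sym (negPf rp) subr0.
    by rewrite -ltNge ltrDl.
  by rewrite !far !mulr0 subrr.
rewrite addr0 vert' H2 => /eqP; rewrite subr_eq0 !mulrA => /eqP /(mulIf O0) E.
have key : vertex_factor p x *
    \prod_(r | r != p) qbr l (lcoord m p x - lcoord m r x + bsq p - hlen p r) =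
    vertex_factor p (x + latC (unit_vec p)) *
    \prod_(r | r != p) qbr l (lcoord m p x - lcoord m r x - hlen p r * (rmul p r)%:R).
  rewrite -!big_split; apply: eq_bigr => r rp /=.
  rewrite gfac_shift // 1?eq_sym // !lcoordD !lcoord_delta // eqxx (negPf rp).
  by rewrite mulr1 mulr0 addr0; congr (gfac p r _ * _); ring.
rewrite /coef_ratio big_split /= prodfV.
move: den0 T'0 E key; set den := \prod_(r | _) _; set num := \prod_(r | _) _.
move: (vertex_factor p (x + _)) => T' den0 T'0 E key.
apply: (mulIf (mulf_neq0 T'0 den0)); rewrite mulrA E -[LHS]mulrA key.
by field.
Qed.

End DeformedOperator.

(** * The theorem *)

Theorem theorem7p5 (R : realType) (n m : nat) (q l : R[i])
    (Psi : 'rV[R[i]]_n.+1 -> 'rV[R[i]]_n.+1 -> R[i])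
    (hm : (0 < m)%N)
    (hq0 : q != 0)
    (hl : cexp l = q)
    (hq : forall k : nat, (0 < k)%N -> q ^+ k != 1)
    (hPsi : normalized_BA m l Psi) :
  (forall f, Rtilde m l f -> exists D : diffop R n, corresponds m Psi f D) /\
  (forall f g (D E : diffop R n), Rtilde m l f -> Rtilde m l g ->
     corresponds m Psi f D -> corresponds m Psi g E -> diffop_commute D E) /\
  [/\ Rtilde m l (mfrak n m q l),
      corresponds m Psi (mfrak n m q l) (Dtilde n m l) &
      forall D : diffop R n, corresponds m Psi (mfrak n m q l) D ->
        diffop_eq D (Dtilde n m l)].
Proof.
have q_not_root k : (0 < k)%N -> qpow l 1 ^+ k != 1 by rewrite /qpow mul1r hl; exact: hq.
have [psi [mer supp exp inv top]] := BA_expansion hm hPsi.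
have shifts (D : diffop R n) : diffop_on_P m D ->
    exists kap : 'I_(dlen D) -> 'rV[int]_n.+1, forall t, dshift t = lat R m (kap t).
  move=> DP; apply: (@fin_all_exists _ _ (fun t k => dshift t = lat R m k)) => t.
  by have [/latP_lat] := DP t.
have Dt : corresponds m Psi (mfrak n m q l) (Dtilde n m l).
  split.
    move=> t; split; last exact: meromorphic_Dtilde.
    by apply/latP_lat; exists (delta_mx ord0 t); rewrite lat_delta.
  apply: (generically_imply (Dtilde_eigen hm q_not_root mer supp exp inv top hl)).
  by move=> x H z; rewrite H.
split; [|split; [|split=> //]].
- move=> f [[s [c [sP fE]]] finv].
  have [kap kapE] : exists kap : 'I_(size s) -> 'rV[int]_n.+1,
      forall i : 'I_(size s), nth 0 s i = lat R m (kap i).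
    apply: (@fin_all_exists _ _ (fun (i : 'I_(size s)) k => nth 0 s i = lat R m k)) => i.
    by apply/latP_lat/sP; rewrite mem_nth.
  pose L := \sum_i \sum_p `|kap i ord0 p|.
  have sumL i : \sum_p `|kap i ord0 p| <= L.
    by rewrite /L (bigD1 i) //= lerDl; do 2!apply: sumr_ge0 => ? _.
  have kapL i : shift_region (- L) (- L) L (kap i).
    apply/andP; split; last first.
      by rewrite -ler_norml; apply: le_trans (sumL i); exact: ler_norm_sum.
    apply/forallP => p; rewrite lerNl; apply: le_trans (sumL i).
    rewrite (bigD1 p) //= ler_wpDr //; first by apply: sumr_ge0.
    by rewrite -normrN ler_norm.
  have fE' z : f z = \sum_(i <- index_enum 'I_(size s))
      c (nth 0 s i) * qpow l (2 * dotp (toC (lat R m (kap i))) z).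
    rewrite fE (big_nth 0) big_mkord; apply: eq_bigr => i _.
    by rewrite kapE.
  have [D [DP _ DE]] := operator_of_function hm q_not_root mer exp inv top kapL fE'
    (quasi_invariant_root finv).
  by exists D; split=> //; apply: (generically_imply DE) => x H z; rewrite H.
- move=> f g D E _ _ [DP DE] [EP EE].
  have [kD kDE] := shifts D DP; have [kE kEE] := shifts E EP.
  pose I := ('I_(dlen D) * 'I_(dlen E) + 'I_(dlen D) * 'I_(dlen E))%type.
  pose kap (i : I) := match i with inl u => kD u.1 + kE u.2 | inr u => kD u.1 + kE u.2 end.
  pose d (i : I) x := match i with
    | inl u => dcoef u.1 x * dcoef u.2 (x + toC (lat R m (kD u.1)))
    | inr u => - (dcoef u.2 x * dcoef u.1 (x + toC (lat R m (kE u.2)))) end.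
  have sumE x F : \sum_i d i x * F (x + toC (lat R m (kap i))) =
      dapp D (dapp E F) x - dapp E (dapp D F) x.
    rewrite big_sumType /=; congr (_ + _).
      rewrite -(pair_bigA _ (fun t u => dcoef t x * dcoef u (x + toC (lat R m (kD t))) *
        F (x + toC (lat R m (kD t + kE u))))) /=.
      apply: eq_bigr => t _; rewrite /dapp mulr_sumr; apply: eq_bigr => u _.
      by rewrite kDE kEE latD toCD addrA mulrA.
    rewrite -(pair_bigA _ (fun t u => - (dcoef u x * dcoef t (x + toC (lat R m (kE u)))) *
        F (x + toC (lat R m (kD t + kE u))))) /= exchange_big -sumrN.
    apply: eq_bigr => u _; rewrite /dapp -mulrN -sumrN mulr_sumr; apply: eq_bigr => t _.
    by rewrite kDE kEE latD toCD (addrC (toC _)) addrA mulrN mulNr mulrA.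
  have DtE := generically_finType (fun t : 'I_(dlen D) => generically_translate (toC (dshift t)) EE).
  have EtD := generically_finType (fun t : 'I_(dlen E) => generically_translate (toC (dshift t)) DE).
  have zero : generically (fun x => forall z,
      \sum_i d i x * Psi (x + toC (lat R m (kap i))) z = 0).
    have all_x := generically_and (generically_and DE EE) (generically_and DtE EtD).
    apply: (generically_imply all_x) => x [[Dx Ex] [DEx EDx]] z.
    rewrite (sumE x (Psi ^~ z)).
    have -> : dapp D (dapp E (Psi ^~ z)) x = g z * dapp D (Psi ^~ z) x.
      rewrite /dapp mulr_sumr; apply: eq_bigr => t _.
      by rewrite -/(dapp E (Psi ^~ z) _) DEx mulrCA.
    have -> : dapp E (dapp D (Psi ^~ z)) x = f z * dapp E (Psi ^~ z) x.
      rewrite /dapp mulr_sumr; apply: eq_bigr => t _.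
      by rewrite -/(dapp D (Psi ^~ z) _) EDx mulrCA.
    by rewrite Dx Ex; ring.
  apply: (generically_imply (Psi_separates_functions hm q_not_root supp exp top zero)).
  by move=> x H F; apply/eqP; rewrite -subr_eq0 -sumE H.
- exact: mfrak_Rtilde.
- move=> D [DP DE].
  have [kD kDE] := shifts D DP.
  pose I := ('I_(dlen D) + 'I_n.+1)%type.
  pose kap (i : I) := match i with inl t => kD t | inr p => delta_mx ord0 p end.
  pose d (i : I) x := match i with
    | inl t => dcoef t x | inr p => - dcoef (d := Dtilde n m l) p x end.
  have sumE x F : \sum_i d i x * F (x + toC (lat R m (kap i))) =
      dapp D F x - dapp (Dtilde n m l) F x.
    rewrite big_sumType /=; congr (_ + _).
      by apply: eq_bigr => t _; rewrite kDE.
    by rewrite /dapp -sumrN; apply: eq_bigr => p _; rewrite lat_delta mulNr.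
  have zero : generically (fun x => forall z,
      \sum_i d i x * Psi (x + toC (lat R m (kap i))) z = 0).
    apply: (generically_imply (generically_and DE Dt.2)) => x [Dx Tx] z.
    by rewrite (sumE x (Psi ^~ z)) Dx Tx subrr.
  apply: (generically_imply (Psi_separates_functions hm q_not_root supp exp top zero)).
  by move=> x H F; apply/eqP; rewrite -subr_eq0 -sumE H.
Qed.
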